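(* Let $G_{4,1}$ be the graph with the $12$ vertices $1,2,3,4_0,4_1,4_2,5_0,5_1,5_2,6_0,6_1,6_2$ and the following $24$ edges: $\{1,2\},\{1,3\},\{2,3\}$; $\{4_1,4_0\},\{4_0,4_2\},\{5_1,5_0\},\{5_0,5_2\},\{6_1,6_0\},\{6_0,6_2\}$; $\{4_1,5_2\},\{5_1,6_2\},\{6_1,4_2\}$; $\{1,4_1\},\{2,4_1\},\{2,4_2\},\{3,4_2\},\{2,5_1\},\{3,5_1\},\{3,5_2\},\{1,5_2\},\{3,6_1\},\{1,6_1\},\{1,6_2\},\{2,6_2\}$. Then the $\mathrm{LS}_+$-rank of $G_{4,1}$ is $4$.
   Context: All graphs are finite, simple and undirected. For a graph $G$, a stable set is a set of pairwise nonadjacent vertices; $\mathrm{STAB}(G)\subseteq\mathbb{R}^{V(G)}$ is the convex hull of the incidence vectors of stable sets of $G$, and $\mathrm{FRAC}(G)=\{x\in[0,1]^{V(G)}: x_i+x_j\le 1 \text{ for all } \{i,j\}\in E(G)\}$. For $P\subseteq[0,1]^n$ let $\mathrm{cone}(P)=\{(\lambda,\lambda x)\in\mathbb{R}^{n+1}:\lambda\ge 0, x\in P\}$, with coordinates indexed by $0,1,\dots,n$. Let $\widehat{\mathrm{LS}}_+(P)$ be the set of symmetric positive semidefinite $(n+1)\times(n+1)$ matrices $Y$ with $Ye_0=\mathrm{diag}(Y)$ and $Ye_i,\ Y(e_0-e_i)\in\mathrm{cone}(P)$ for all $i\in[n]$, and $\mathrm{LS}_+(P)=\{x\in\mathbb{R}^n:\exists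 Y\in\widehat{\mathrm{LS}}_+(P),\ Ye_0=(1,x)\}$. Set $\mathrm{LS}_+^0(P)=P$, $\mathrm{LS}_+^k(P)=\mathrm{LS}_+(\mathrm{LS}_+^{k-1}(P))$, and $\mathrm{LS}_+^k(G)=\mathrm{LS}_+^k(\mathrm{FRAC}(G))$. The $\mathrm{LS}_+$-rank $r_+(G)$ of $G$ is the least integer $k\ge 0$ with $\mathrm{LS}_+^k(G)=\mathrm{STAB}(G)$. *)

(* Defs.v *)
From HB Require Import structures.
From mathcomp Require Import all_boot all_order all_algebra.
From mathcomp Require Import boolp classical_sets reals.

Set Implicit Arguments.
Unset Strict Implicit.
Unset Printing Implicit Defensive.

Import Order.TTheory GRing.Theory Num.Theory.
Local Open Scope classical_set_scope.
Local Open Scope ring_scope.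

(** Finite simple graphs on the vertex set 'I_n, so that R^{V(G)} is 'cV[R]_n. *)
Record sgraph (n : nat) := SGraph {
  adj :> rel 'I_n;
  adj_sym : symmetric adj;
  adj_irrefl : irreflexive adj }.

Definition stable n (G : sgraph n) (S : {set 'I_n}) : Prop :=
  forall i j, i \in S -> j \in S -> ~~ G i j.

Section LSplus.
Variable R : realType.

Definition convex_hull (V : lmodType R) (A : set V) : set V :=
  [set x | exists (k : nat) (w : 'I_k -> R) (v : 'I_k -> V),
     [/\ forall i, 0 <= w i, \sum_i w i = 1, forall i, A (v i)
       & x = \sum_i w i *: v i]].

Definition incidence n (S : {set 'I_n}) : 'cV[R]_n := \col_i (i \in S)%:R.

Definition STAB n (G : sgraph n) : set 'cV[R]_n :=
  convex_hull [set x | exists2 S, stable G S & x = incidence S].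

Definition FRAC n (G : sgraph n) : set 'cV[R]_n :=
  [set x | (forall i, 0 <= x i 0 <= 1) /\
           (forall i j, G i j -> x i 0 + x j 0 <= 1)].

(** Vectors of R^{n+1} have type 'cV_(1 + n): coordinate 0 is [lshift n 0] and
    coordinate i of [n] is [rshift 1 i]; (a, x) is [col_mx a%:M x]. *)
Definition cone n (P : set 'cV[R]_n) : set 'cV[R]_(1 + n) :=
  [set y | exists (a : R) (x : 'cV[R]_n),
     [/\ 0 <= a, P x & y = col_mx a%:M (a *: x)]].

Definition e0 n : 'cV[R]_(1 + n) := delta_mx (lshift n 0) 0.
Definition e_ n (i : 'I_n) : 'cV[R]_(1 + n) := delta_mx (rshift 1 i) 0.

Definition diagv n (Y : 'M[R]_n) : 'cV[R]_n := \col_i Y i i.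

Definition sym_psd n (Y : 'M[R]_n) : Prop :=
  Y^T = Y /\ forall z : 'cV[R]_n, 0 <= (z^T *m Y *m z) 0 0.

Definition LSplus_hat n (P : set 'cV[R]_n) : set 'M[R]_(1 + n) :=
  [set Y | [/\ sym_psd Y,
               Y *m e0 n = diagv Y
             & forall i : 'I_n,
                 cone P (Y *m e_ i) /\ cone P (Y *m (e0 n - e_ i))]].

Definition LSplus n (P : set 'cV[R]_n) : set 'cV[R]_n :=
  [set x | exists2 Y, LSplus_hat P Y & Y *m e0 n = col_mx 1%:M x].

Definition LSplus_iter n (k : nat) (G : sgraph n) : set 'cV[R]_n :=
  iter k (@LSplus n) (FRAC G).

Definition is_LSplus_rank n (G : sgraph n) (k : nat) : Prop :=
  LSplus_iter k G = STAB G /\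
  forall j, (j < k)%N -> LSplus_iter j G <> STAB G.

End LSplus.

(** [v4_1] stands for the vertex 4_1 and so on. *)
Definition v1   : 'I_12 := @Ordinal 12 0 isT.
Definition v2   : 'I_12 := @Ordinal 12 1 isT.
Definition v3   : 'I_12 := @Ordinal 12 2 isT.
Definition v4_0 : 'I_12 := @Ordinal 12 3 isT.
Definition v4_1 : 'I_12 := @Ordinal 12 4 isT.
Definition v4_2 : 'I_12 := @Ordinal 12 5 isT.
Definition v5_0 : 'I_12 := @Ordinal 12 6 isT.
Definition v5_1 : 'I_12 := @Ordinal 12 7 isT.
Definition v5_2 : 'I_12 := @Ordinal 12 8 isT.
Definition v6_0 : 'I_12 := @Ordinal 12 9 isT.
Definition v6_1 : 'I_12 := @Ordinal 12 10 isT.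
Definition v6_2 : 'I_12 := @Ordinal 12 11 isT.

Definition G41_edges : seq ('I_12 * 'I_12) :=
  [:: (v1, v2); (v1, v3); (v2, v3);
      (v4_1, v4_0); (v4_0, v4_2);
      (v5_1, v5_0); (v5_0, v5_2);
      (v6_1, v6_0); (v6_0, v6_2);
      (v4_1, v5_2); (v5_1, v6_2); (v6_1, v4_2);
      (v1, v4_1); (v2, v4_1); (v2, v4_2); (v3, v4_2);
      (v2, v5_1); (v3, v5_1); (v3, v5_2); (v1, v5_2);
      (v3, v6_1); (v1, v6_1); (v1, v6_2); (v2, v6_2)].

Definition G41_adj : rel 'I_12 :=
  fun i j => ((i, j) \in G41_edges) || ((j, i) \in G41_edges).

Fact G41_sym : symmetric G41_adj.
Proof. by move=> i j; rewrite /G41_adj orbC. Qed.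

Fact G41_irrefl : irreflexive G41_adj.
Proof.
move=> i; rewrite /G41_adj orbb; apply/negP.
by have /allP no_loop : all (fun e => e.1 != e.2) G41_edges by [];
  move/no_loop; rewrite /= eqxx.
Qed.

Definition G41 : sgraph 12 := SGraph G41_sym G41_irrefl.

(* Main.v *)
Require Import Defs.
From Stdlib Require Import ZArith.
From HB Require Import structures.
From mathcomp Require Import all_boot all_order all_algebra.
From mathcomp Require Import boolp classical_sets reals interval_inference convex.
From mathcomp Require Import lra ring zify ssrZ.

(** Upper bound. Let x be in LS_+(P) with certificate Y and let a.x <= b, with
    a >= 0, be valid for STAB(G). If P satisfies the valid inequalities supported
    off the closed neighbourhood of i, then column i of Y satisfies a.y <= b y_0;
    weighting these by the a_i, the Cauchy-Schwarz inequality for the form Y gives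
    (a.x)^2 <= b (a.x). A vertex with at most one neighbour in the support of a
    can be split off with an edge inequality, so each LS_+ step removes at least
    three vertices from the support: LS_+^k(G) = STAB(G) as soon as
    |V(G)| <= 3k + 2.

    Lower bound. All stable sets of G_{4,1} have at most 4 vertices, but LS_+^3
    contains a point with coordinate sum above 4. Membership is certified by
    integer matrices. In the level 3 matrix, up to automorphism, each column
    Ye_i or Y(e_0 - e_i) is either a conic combination of incidence vectors of
    stable sets or the first column of one of three level 2 matrices; the
    columns of these are treated likewise with 22 level 1 matrices. *)

Set Implicit Arguments.
Unset Strict Implicit.
Unset Printing Implicit Defensive.

Import Order.TTheory GRing.Theory Num.Theory.
Local Open Scope classical_set_scope.
Local Open Scope ring_scope.

(** * Convex sets and convex cones *)

Lemma convex_setP (R : numDomainType) (V : lmodType R) (P : set V) :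
  convex_set P <->
  forall x y (a : R), 0 <= a <= 1 -> P x -> P y -> P (a *: x + (1 - a) *: y).
Proof.
split=> [cvxP x y a /andP[a0 a1] /mem_set Px /mem_set Py|cvxP x y a].
  exact: set_mem (cvxP x y (Itv01 a0 a1) Px Py).
by rewrite !inE => Px Py; apply: cvxP => //; rewrite ge0 le1.
Qed.

Section ConvexCone.
Variables (R : numDomainType) (V : lmodType R).
Implicit Types K : set V.

Definition convex_cone K : Prop :=
  (forall u v, K u -> K v -> K (u + v)) /\
  (forall (a : R) u, 0 <= a -> K u -> K (a *: u)).

Lemma convex_cone0 K u : convex_cone K -> K u -> K 0.
Proof. by move=> [_ KZ] Ku; rewrite -(scale0r u); apply: KZ. Qed.

End ConvexCone.

Section Farkas.
Variables (R : realFieldType) (d : nat).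
Implicit Types (u v b y z : 'cV[R]_d) (us : seq 'cV[R]_d) (K : set 'cV[R]_d).

Definition dot u v : R := (u^T *m v) 0 0.

Lemma dotE u v : dot u v = \sum_i u i 0 * v i 0.
Proof. by rewrite /dot mxE; under eq_bigr do rewrite mxE. Qed.

Lemma dotC u v : dot u v = dot v u.
Proof. by rewrite !dotE; under eq_bigr do rewrite mulrC. Qed.

Lemma dotBr u v w : dot u (v - w) = dot u v - dot u w.
Proof. by rewrite /dot mulmxBr !mxE. Qed.

Lemma dotZr (a : R) u v : dot u (a *: v) = a * dot u v.
Proof. by rewrite /dot -scalemxAr mxE. Qed.

Lemma dot_self_le0 u : dot u u <= 0 -> u = 0.
Proof.
have sq_ge0 i : 0 <= u i 0 * u i 0 by rewrite -expr2 sqr_ge0.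
rewrite dotE le_eqVlt ltNge sumr_ge0 // orbF => /eqP uu0; apply/colP => i.
apply/eqP; rewrite mxE -[_ == 0]orbb -mulf_eq0; apply/eqP.
exact: (psumr_eq0P (fun i _ => sq_ge0 i) uu0).
Qed.

(* Induction on the list of generators: if y separates b from all of them but u,
   then projecting along u onto the hyperplane orthogonal to y kills u and sends
   the other generators to points of the cone. *)
Lemma farkas K us b : convex_cone K -> K 0 -> (forall u, u \in us -> K u) ->
  (forall y, (forall u, u \in us -> dot y u <= 0) -> dot y b <= 0) -> K b.
Proof.
move=> [KD KZ] K0; have [m] := ubnP (size us).
elim: m us b => // m IH [|u us] b /= size_us Kus b_sep.
  by rewrite (@dot_self_le0 b) ?b_sep.
have Kv v : v \in us -> K v by move=> vus; apply: Kus; rewrite inE vus orbT.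
have [|] := pselect (forall y, (forall v, v \in us -> dot y v <= 0) -> dot y b <= 0).
  exact: IH.
move=> /existsNP[y /not_implyP[y_us /negP]]; rewrite -ltNge => yb.
have yu : 0 < dot y u.
  rewrite ltNge; apply: contraTN yb => yu; rewrite -leNgt.
  by apply: b_sep => v; rewrite inE => /predU1P[->//|]; apply: y_us.
pose coef v := dot y v / dot y u; pose proj v := v - coef v *: u.
have dot_proj z v : dot z (proj v) = dot (z - (dot z u / dot y u) *: y) v.
  by rewrite dotBr dotZr [RHS]dotC dotBr dotZr !(dotC v) /coef; ring.
have Kproj v : v \in us -> K (proj v).
  move=> vus; rewrite /proj -scaleNr; apply: KD; first exact: Kv.
  apply: KZ; last by apply: Kus; rewrite mem_head.
  by rewrite oppr_ge0 mulr_le0_ge0 ?y_us // invr_ge0 ltW.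
rewrite -(subrK (coef b *: u) b); apply: KD; last first.
  by apply: KZ; [rewrite divr_ge0 // ltW | apply: Kus; rewrite mem_head].
apply: (IH (map proj us)) => [|v /mapP[w /Kproj Kw ->]|z z_us] //.
  by rewrite size_map.
rewrite -/(proj b) dot_proj; apply: b_sep => v; rewrite inE -dot_proj.
move=> /predU1P[->|vus]; last by rewrite z_us ?map_f.
by rewrite /proj dotBr dotZr /coef divff ?gt_eqF // mul1r subrr.
Qed.

End Farkas.

Section ConvexHull.
Variables (R : realType) (V : lmodType R).
Implicit Types A P : set V.

Lemma subset_convex_hull A : A `<=` convex_hull A.
Proof.
move=> x Ax; exists 1%N, (fun=> 1), (fun=> x).
by split=> //; rewrite big_ord1 ?scale1r.
Qed.

Lemma convex_convex_hull A : convex_set (convex_hull A).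
Proof.
apply/convex_setP => x y a /andP[a0 a1] [k [w [v [w0 w1 Av ->]]]].
move=> [l [w' [v' [w'0 w'1 Av' ->]]]].
pose weight (i : 'I_k + 'I_l) :=
  match i with inl j => a * w j | inr j => (1 - a) * w' j end.
pose point (i : 'I_k + 'I_l) := match i with inl j => v j | inr j => v' j end.
exists (k + l)%N, (weight \o split), (point \o split); split=> /=.
- by move=> i; rewrite /weight; case: splitP => j _; rewrite mulr_ge0 // subr_ge0.
- rewrite big_split_ord /=.
  under eq_bigr do rewrite (unsplitK (inl _)).
  under [X in _ + X]eq_bigr do rewrite (unsplitK (inr _)).
  by rewrite -!mulr_sumr w1 w'1 !mulr1 addrC subrK.
- by move=> i; rewrite /point; case: split.
- rewrite big_split_ord !scaler_sumr; congr (_ + _); apply: eq_bigr => i _.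
    by rewrite (unsplitK (inl _)) scalerA.
  by rewrite (unsplitK (inr _)) scalerA.
Qed.

Lemma convex_hull_subset A P : convex_set P -> A `<=` P -> convex_hull A `<=` P.
Proof.
move=> /convex_setP cvxP AP x [k [w [v [w0 w1 Av ->]]]].
elim: k w v w0 w1 Av => [|k IH] w v w0 w1 Av.
  by move: w1; rewrite big_ord0 => /esym/eqP; rewrite oner_eq0.
move: w1; rewrite !big_ord_recl; set s := \sum_(i < k) _ => w1.
have s0 : 0 <= s by apply: sumr_ge0.
have Pv0 : P (v ord0) by apply/AP/Av.
have [s_eq0|s_neq0] := eqVneq s 0.
  rewrite big1 => [|i _]; first by rewrite -[w ord0]addr0 -s_eq0 w1 scale1r addr0.
  by rewrite (psumr_eq0P _ s_eq0) ?scale0r.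
pose rest := \sum_(i < k) (w (lift ord0 i) / s) *: v (lift ord0 i).
have -> : \sum_(i < k) w (lift ord0 i) *: v (lift ord0 i) = (1 - w ord0) *: rest.
  rewrite -w1 addrC addKr scaler_sumr; apply: eq_bigr => i _.
  by rewrite scalerA mulrC divfK.
apply: cvxP Pv0 _; first by rewrite w0 -w1 lerDl.
apply: IH => // [i|]; first by rewrite divr_ge0.
by rewrite -mulr_suml divff.
Qed.

End ConvexHull.

(** * Homogenization *)

(* Locked, so that [mxE] does not unfold the block decomposition. *)
HB.lock Definition homog (R : pzSemiRingType) n (x : 'cV[R]_n) : 'cV[R]_(1 + n) :=
  col_mx 1%:M x.

Section Homogenization.
Variables (R : pzSemiRingType) (n : nat).
Implicit Types (x : 'cV[R]_n) (u v : 'cV[R]_(1 + n)).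

Lemma homogE x : homog x = col_mx 1%:M x.
Proof. by rewrite unlock. Qed.

Lemma homog0 x : homog x (lshift n 0) 0 = 1.
Proof. by rewrite homogE col_mxEu mxE. Qed.

Lemma homogS x i : homog x (rshift 1 i) 0 = x i 0.
Proof. by rewrite homogE col_mxEd. Qed.

Lemma colP_homog u v :
  u (lshift n 0) 0 = v (lshift n 0) 0 ->
  (forall i, u (rshift 1 i) 0 = v (rshift 1 i) 0) -> u = v.
Proof.
by move=> uv0 uvS; apply/colP => i; case: (split_ordP i) => j ->; rewrite ?[j]ord1.
Qed.

End Homogenization.

Lemma dot_homog (R : realFieldType) n (y : 'cV[R]_(1 + n)) (x : 'cV[R]_n) :
  dot y (homog x) = y (lshift n 0) 0 + \sum_i y (rshift 1 i) 0 * x i 0.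
Proof.
rewrite dotE big_split_ord big_ord1 /= homog0 mulr1; congr (_ + _).
by under eq_bigr do rewrite homogS.
Qed.

Lemma homog_normalize (R : fieldType) n (u : 'cV[R]_(1 + n)) (a := u (lshift n 0) 0) :
  a != 0 -> homog (a^-1 *: dsubmx u) = a^-1 *: u.
Proof.
by move=> a0; apply: colP_homog => [|i]; rewrite ?homog0 ?homogS !mxE ?mulVf.
Qed.

Section Cone.
Variables (R : realType) (n : nat).
Implicit Types (P Q : set 'cV[R]_n) (x : 'cV[R]_n) (u : 'cV[R]_(1 + n)).

Lemma coneE P u : cone P u <-> exists (a : R) x, [/\ 0 <= a, P x & u = a *: homog x].
Proof.
have homogZ (a : R) x : a *: homog x = col_mx a%:M (a *: x).
  by rewrite homogE scale_col_mx scale_scalar_mx mulr1.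
by split=> -[a [x [a0 Px ->]]]; exists a, x; rewrite homogZ.
Qed.

Lemma cone_gt0 P u : 0 < u (lshift n 0) 0 -> cone P u ->
  exists2 x, P x & u = u (lshift n 0) 0 *: homog x.
Proof.
by move=> u0 /coneE[a [x [a0 Px uE]]]; exists x; rewrite // {2}uE mxE homog0 mulr1.
Qed.

Lemma cone_of_normalized P u (a := u (lshift n 0) 0) :
  0 < a -> P (a^-1 *: dsubmx u) -> cone P u.
Proof.
move=> a0 Pu; apply/coneE; exists a, (a^-1 *: dsubmx u).
by rewrite homog_normalize ?scalerA ?mulfV ?scale1r ?gt_eqF ?ltW.
Qed.

Lemma cone_homog P x : cone P (homog x) <-> P x.
Proof.
split=> [|Px]; last by apply/coneE; exists 1, x; split; rewrite ?scale1r.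
move=> /cone_gt0[|y Py]; first by rewrite homog0.
by rewrite homog0 scale1r !homogE => /eq_col_mx[_ ->].
Qed.

Lemma cone_subset P Q : P `<=` Q -> cone P `<=` cone Q.
Proof. by move=> PQ u [a [x [a0 Px ->]]]; exists a, x; split => //; apply: PQ. Qed.

Lemma convex_cone_cone P : convex_set P -> convex_cone (cone P).
Proof.
move=> /convex_setP cvxP; split=> [u v|a u a0]; rewrite !coneE; last first.
  by move=> [b [x [b0 Px ->]]]; exists (a * b), x; rewrite scalerA mulr_ge0.
move=> [a [x [a0 Px ->]]] [b [y [b0 Py ->]]].
have [ab0|ab_neq0] := eqVneq (a + b) 0.
  exists 0, x; split=> //; have [-> ->] : a = 0 /\ b = 0 by split; lra.
  by rewrite !scale0r addr0.
have ab_gt0 : 0 < a + b by rewrite lt_def ab_neq0 addr_ge0.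
exists (a + b), (a / (a + b) *: x + (1 - a / (a + b)) *: y); split.
- exact: ltW.
- by apply: cvxP => //; rewrite divr_ge0 ?(ltW ab_gt0) //= ler_pdivrMr // mul1r lerDl.
- by apply: colP_homog => [|i]; rewrite !mxE ?homog0 ?homogS ?mxE; field.
Qed.

End Cone.

(** * Symmetric positive semidefinite matrices *)

Section SymPsd.
Variable R : realType.

Lemma convex_cone_sym_psd n : convex_cone (@sym_psd R n).
Proof.
split=> [A B [symA psdA] [symB psdB]|a A a0 [symA psdA]]; split=> [|z].
- by rewrite linearD /= symA symB.
- by rewrite mulmxDr mulmxDl mxE addr_ge0.
- by rewrite linearZ /= symA.
- by rewrite -scalemxAr -scalemxAl mxE mulr_ge0.
Qed.

Lemma sym_psd_sqr n (u : 'cV[R]_n) : sym_psd (u *m u^T).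
Proof.
split=> [|z]; first by rewrite trmx_mul trmxK.
rewrite mulmxA -mulmxA mxE big_ord1 -/(dot z u) -/(dot u z) dotC -expr2.
exact: sqr_ge0.
Qed.

Lemma sym_psd_cauchy_schwarz n (A : 'M[R]_n) (u v : 'cV[R]_n) :
  sym_psd A -> dot v (A *m u) ^+ 2 <= dot u (A *m u) * dot v (A *m v).
Proof.
move=> [symA psdA]; have uAv : dot u (A *m v) = dot v (A *m u).
  by rewrite dotC /dot trmx_mul symA mulmxA.
have form_ge0 w : 0 <= dot w (A *m w) by have := psdA w; rewrite -mulmxA.
have form_comb (s t : R) : dot (s *: v - t *: u) (A *m (s *: v - t *: u)) =
    s ^+ 2 * dot v (A *m v) - 2 * s * t * dot v (A *m u) + t ^+ 2 * dot u (A *m u).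
  rewrite mulmxBr -!scalemxAr dotBr !dotZr !(dotC (_ - _)) !dotBr !dotZr.
  by rewrite !(dotC (A *m _)) uAv; ring.
have uu0 := form_ge0 u; have vv0 := form_ge0 v.
set uu := dot u _ in form_comb uu0 *; set vv := dot v (A *m v) in form_comb vv0 *.
set uv := dot v (A *m u) in form_comb *.
have [uu_eq0|uu_neq0] := eqVneq uu 0.
  by have := form_ge0 (uv *: v - (vv + 1) *: u); rewrite form_comb uu_eq0; nra.
have uu_gt0 : 0 < uu by rewrite lt_def uu_neq0.
rewrite -subr_ge0 -(pmulr_rge0 _ uu_gt0).
by have := form_ge0 (uu *: v - uv *: u); rewrite form_comb; nra.
Qed.

Lemma sym_psd_mxsub m n (f : 'I_m -> 'I_n) (A : 'M[R]_n) :
  sym_psd A -> sym_psd (mxsub f f A).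
Proof.
move=> [symA psdA]; split=> [|z]; first by rewrite trmx_mxsub symA.
pose F : 'M[R]_(m, n) := rowsub f 1%:M.
have -> : mxsub f f A = F *m A *m F^T.
  by rewrite -rowsubE trmx_mxsub trmx1 mulmx_colsub mulmx1 -mxsubcr.
by have := psdA (F^T *m z); rewrite trmx_mul trmxK !mulmxA.
Qed.

Lemma sym_psd_block0 m n (A : 'M[R]_n) :
  sym_psd A -> sym_psd (block_mx (0 : 'M_m) 0 0 A).
Proof.
move=> [symA psdA]; split=> [|z]; first by rewrite tr_block_mx !trmx0 symA.
rewrite -[z]vsubmxK tr_col_mx mul_row_block !mulmx0 !add0r mul_row_col mul0mx add0r.
exact: psdA.
Qed.

Lemma sym_psd_zero_row n (A : 'M[R]_(1 + n)) :
  A^T = A -> (forall j, A (lshift n 0) j = 0) -> sym_psd (drsubmx A) -> sym_psd A.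
Proof.
move=> symA row0 psdA; suff <- : block_mx (0 : 'M_1) 0 0 (drsubmx A) = A.
  exact: sym_psd_block0.
have col0 i : A i (lshift n 0) = 0 by rewrite -symA mxE row0.
rewrite -[RHS]submxK; congr block_mx; apply/matrixP => i j; rewrite !mxE.
- by rewrite [i]ord1 row0.
- by rewrite [i]ord1 row0.
- by rewrite [j]ord1 col0.
Qed.

(* p A is the sum of the square of the first column of A and of the Schur
   complement bordered by zeros. *)
Lemma sym_psd_schur n (A : 'M[R]_(1 + n)) (p := A (lshift n 0) (lshift n 0)) :
  A^T = A -> 0 < p ->
  sym_psd (p *: drsubmx A - dlsubmx A *m ursubmx A) -> sym_psd A.
Proof.
move=> symA p0 psdS; have [psdD psdZ] := convex_cone_sym_psd (1 + n).
set u := col (lshift n 0) A; suff <- : p^-1 *: (u *m u^T + block_mx 0 0 0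
    (p *: drsubmx A - dlsubmx A *m ursubmx A)) = A.
  apply: psdZ; first by rewrite invr_ge0 ltW.
  by apply: psdD; [apply: sym_psd_sqr | apply: sym_psd_block0].
apply: (canLR (scalerK _)); first by rewrite gt_eqF.
have A0 i : A (lshift n 0) i = A i (lshift n 0) by rewrite -[in LHS]symA mxE.
apply/matrixP => i j; rewrite [LHS]mxE [X in X + _]mxE big_ord1.
case: (split_ordP i) => k ->; case: (split_ordP j) => l ->.
all: rewrite ?block_mxEul ?block_mxEur ?block_mxEdl ?block_mxEdr !mxE ?big_ord1 ?mxE.
all: by rewrite ?[k]ord1 ?[l]ord1 /p ?A0; ring.
Qed.

End SymPsd.

(** * The operator LS_+ *)

Section LSplusTheory.
Variable R : realType.

Section Certificates.
Variable n : nat.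
Implicit Types (P : set 'cV[R]_n) (x : 'cV[R]_n) (Y : 'M[R]_(1 + n)).

Lemma LSplus_hatP P Y : LSplus_hat P Y <->
  [/\ sym_psd Y, forall i, Y i (lshift n 0) = Y i i,
      forall i, cone P (col (rshift 1 i) Y)
    & forall i, cone P (col (lshift n 0) Y - col (rshift 1 i) Y)].
Proof.
have eqE : (Y *m e0 R n = diagv Y) <-> forall i, Y i (lshift n 0) = Y i i.
  rewrite -colE; split=> [/colP Y0 i|Y0]; last by apply/colP => i; rewrite !mxE.
  by have := Y0 i; rewrite !mxE.
have colsE i : (Y *m e_ R i = col (rshift 1 i) Y) *
    (Y *m (e0 R n - e_ R i) = col (lshift n 0) Y - col (rshift 1 i) Y).
  by rewrite mulmxBr -!colE.
split=> [[psdY /eqE Y0 cY]|[psdY /eqE Y0 cY cY']]; split=> // i.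
- by have [] := cY i; rewrite colsE.
- by have [] := cY i; rewrite !colsE.
- by rewrite !colsE.
Qed.

Lemma LSplusP P x :
  LSplus P x <-> exists2 Y, LSplus_hat P Y & col (lshift n 0) Y = homog x.
Proof. by split=> -[Y hatY Yx]; exists Y; rewrite // colE homogE in Yx *. Qed.

Lemma convex_cone_LSplus_hat P : convex_set P -> convex_cone (LSplus_hat P).
Proof.
move=> /convex_cone_cone[cD cZ]; have [psdD psdZ] := @convex_cone_sym_psd R (1 + n).
split=> [A B|a A a0]; rewrite !LSplus_hatP.
  move=> [psdA A0 cA cA'] [psdB B0 cB cB']; split=> [|i|i|i]; first exact: psdD.
  - by rewrite !mxE A0 B0.
  - by rewrite linearD /=; apply: cD.
  - by rewrite !linearD /= addrACA; apply: cD.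
move=> [psdA A0 cA cA']; split=> [|i|i|i]; first exact: psdZ.
- by rewrite !mxE A0.
- by rewrite linearZ /=; apply: cZ.
- by rewrite !linearZ /= -scalerDr; apply: cZ.
Qed.

Lemma cone_LSplus P Y : convex_set P -> LSplus_hat P Y ->
  0 < Y (lshift n 0) (lshift n 0) -> cone (LSplus P) (col (lshift n 0) Y).
Proof.
move=> cvxP hatY Y00; pose a := col (lshift n 0) Y (lshift n 0) 0.
have a0 : 0 < a by rewrite /a mxE.
apply: cone_of_normalized => //; apply/LSplusP; exists (a^-1 *: Y).
  by apply: (convex_cone_LSplus_hat cvxP).2; rewrite // invr_ge0 ltW.
by rewrite linearZ /= homog_normalize ?gt_eqF.
Qed.

Lemma convex_LSplus P : convex_set P -> convex_set (LSplus P).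
Proof.
move=> cvxP; have [hatD hatZ] := convex_cone_LSplus_hat cvxP.
apply/convex_setP => x y a /andP[a0 a1] /LSplusP[A hatA Ax] /LSplusP[B hatB By].
apply/LSplusP; exists (a *: A + (1 - a) *: B).
  by apply: hatD; apply: hatZ; rewrite ?subr_ge0.
rewrite linearD !linearZ /= Ax By.
by apply: colP_homog => [|i]; rewrite !mxE ?homog0 ?homogS ?mxE; ring.
Qed.

Lemma LSplus_subset P : (0 < n)%N -> convex_set P -> LSplus P `<=` P.
Proof.
move=> n0 /convex_cone_cone[cD _] x /LSplusP[Y /LSplus_hatP[_ _ cY cY'] Yx].
apply/cone_homog; rewrite -Yx -(subrK (col (rshift 1 (Ordinal n0)) Y) (col _ _)).
exact: cD.
Qed.

Lemma LSplus_incidence P (S : {set 'I_n}) :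
  P (incidence R S) -> LSplus P (incidence R S).
Proof.
set x := incidence R S => Px; pose u := homog x.
have u_idem i : u i 0 * u i 0 = u i 0.
  case: (split_ordP i) => j ->; rewrite ?[j]ord1 ?homog0 ?homogS ?mulr1 // mxE.
  by case: (j \in S); rewrite ?mulr1 ?mulr0.
have colY i : col i (u *m u^T) = u i 0 *: u.
  by apply/colP => j; rewrite !mxE big_ord1 mxE mulrC.
apply/LSplusP; exists (u *m u^T); last by rewrite colY homog0 scale1r.
apply/LSplus_hatP; split=> [|i|i|i]; first exact: sym_psd_sqr.
- by rewrite !mxE !big_ord1 !mxE homog0 mulr1 u_idem.
- by rewrite colY homogS mxE; apply/coneE; exists (i \in S)%:R, x; rewrite ler0n.
- rewrite !colY homog0 homogS mxE -scalerBl; apply/coneE.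
  by exists (1 - (i \in S)%:R), x; rewrite subr_ge0 lern1 leq_b1.
Qed.

End Certificates.

Section RowSub.
Variables (m n : nat) (s : 'I_m -> 'I_n).
Variables (P : set 'cV[R]_n) (Q : set 'cV[R]_m).
Hypothesis PQ : forall x, P x -> Q (rowsub s x).

Definition homog_map (i : 'I_(1 + m)) : 'I_(1 + n) :=
  match split i with inl j => lshift n j | inr j => rshift 1 (s j) end.

Lemma homog_map0 : homog_map (lshift m 0) = lshift n 0.
Proof. by rewrite /homog_map (unsplitK (inl _)). Qed.

Lemma homog_mapS i : homog_map (rshift 1 i) = rshift 1 (s i).
Proof. by rewrite /homog_map (unsplitK (inr _)). Qed.

Lemma rowsub_homog (x : 'cV[R]_n) :
  rowsub homog_map (homog x) = homog (rowsub s x).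
Proof.
by apply: colP_homog => [|i]; rewrite mxE ?homog_map0 ?homog_mapS ?homog0 ?homogS ?mxE.
Qed.

Lemma cone_rowsub (u : 'cV[R]_(1 + n)) : cone P u -> cone Q (rowsub homog_map u).
Proof.
move=> /coneE[a [x [a0 Px ->]]]; apply/coneE; exists a, (rowsub s x).
by rewrite linearZ /= rowsub_homog; split=> //; apply: PQ.
Qed.

Lemma LSplus_rowsub x : LSplus P x -> LSplus Q (rowsub s x).
Proof.
move=> /LSplusP[Y /LSplus_hatP[psdY Y0 cY cY'] Yx].
pose Z := mxsub homog_map homog_map Y.
have colZ i : col i Z = rowsub homog_map (col (homog_map i) Y).
  by rewrite col_mxsub; apply/colP => j; rewrite !mxE.
apply/LSplusP; exists Z; last by rewrite colZ homog_map0 Yx rowsub_homog.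
apply/LSplus_hatP; split=> [|i|i|i]; first exact: sym_psd_mxsub.
- by rewrite !mxE homog_map0 Y0.
- by rewrite colZ homog_mapS; apply: cone_rowsub.
- by rewrite !colZ homog_map0 homog_mapS -linearB; apply: cone_rowsub.
Qed.

End RowSub.

Section LSplusIter.

Lemma stable0 n (G : sgraph n) : stable G finset.set0.
Proof. by move=> i j; rewrite inE. Qed.

Lemma stable_sub n (G : sgraph n) (S T : {set 'I_n}) :
  S \subset T -> stable G T -> stable G S.
Proof. by move=> /fintype.subsetP ST stT i j /ST iT /ST jT; apply: stT. Qed.

Lemma STAB_incidence n (G : sgraph n) (S : {set 'I_n}) :
  stable G S -> STAB G (incidence R S).
Proof. by move=> stS; apply: subset_convex_hull; exists S. Qed.

Lemma convex_cone_cone_STAB n (G : sgraph n) : convex_cone (cone (STAB (R := R) G)).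
Proof. exact/convex_cone_cone/convex_convex_hull. Qed.

Lemma cone_STAB_incidence n (G : sgraph n) (S : {set 'I_n}) :
  stable G S -> cone (STAB G) (homog (incidence R S)).
Proof. by move=> stS; apply/cone_homog/STAB_incidence. Qed.

Lemma cone_STAB0 n (G : sgraph n) : cone (STAB (R := R) G) 0.
Proof.
exact: convex_cone0 (convex_cone_cone_STAB G) (cone_STAB_incidence (@stable0 n G)).
Qed.

Lemma convex_FRAC n (G : sgraph n) : convex_set (FRAC G : set 'cV[R]_n).
Proof.
apply/convex_setP => x y a /andP[a0 a1] [x01 xE] [y01 yE]; split=> [i|i j Gij].
  rewrite !mxE; have /andP[x0 x1] := x01 i; have /andP[y0 y1] := y01 i.
  by apply/andP; split; nra.
by rewrite !mxE; have := xE _ _ Gij; have := yE _ _ Gij; nra.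
Qed.

Lemma FRAC_incidence n (G : sgraph n) (S : {set 'I_n}) :
  stable G S -> FRAC G (incidence R S).
Proof.
move=> stS; split=> [i|i j Gij]; rewrite !mxE; first by rewrite ler0n lern1 leq_b1.
rewrite -natrD lern1; move: (stS i j); case: (i \in S); case: (j \in S) => //.
by rewrite Gij => /(_ isT isT).
Qed.

Lemma convex_LSplus_iter n (G : sgraph n) k :
  convex_set (LSplus_iter k G : set 'cV[R]_n).
Proof. by elim: k => [|k IH]; [apply: convex_FRAC | apply: convex_LSplus]. Qed.

Lemma STAB_subset_LSplus_iter n (G : sgraph n) k :
  STAB (R := R) G `<=` LSplus_iter k G.
Proof.
apply: convex_hull_subset => [|_ [S stS ->]]; first exact: convex_LSplus_iter.
by elim: k => [|k IH]; [apply: FRAC_incidence | apply: LSplus_incidence].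
Qed.

Lemma cone_FRAC_of_ineqs n (G : sgraph n) (u : 'cV[R]_(1 + n)) :
  [/\ 0 <= u (lshift n 0) 0,
      forall i, 0 <= u (rshift 1 i) 0 <= u (lshift n 0) 0
    & forall i j, G i j ->
        u (rshift 1 i) 0 + u (rshift 1 j) 0 <= u (lshift n 0) 0] ->
  cone (FRAC G) u.
Proof.
move=> [u0 u_bound u_edge]; set a := u (lshift n 0) 0 in u0 u_bound u_edge *.
have [a_eq0|a_neq0] := eqVneq a 0.
  suff -> : u = 0.
    exact: cone_subset (@STAB_subset_LSplus_iter n G 0) _ (@cone_STAB0 n G).
  apply: colP_homog => [|i]; rewrite mxE //.
  by have := u_bound i; rewrite a_eq0 -eq_le => /eqP.
have a_gt0 : 0 < a by rewrite lt_def a_neq0.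
apply: cone_of_normalized => //; split=> [i|i j Gij]; rewrite !mxE.
  have /andP[ui0 ui_le] := u_bound i.
  by rewrite mulr_ge0 ?invr_ge0 //= ler_pdivrMl // mulr1.
by rewrite -mulrDr ler_pdivrMl // mulr1 u_edge.
Qed.

Lemma LSplus_iter_subset n (G : sgraph n) k l :
  (0 < n)%N -> (k <= l)%N -> LSplus_iter (R := R) l G `<=` LSplus_iter k G.
Proof.
move=> n0 /subnK <-; elim: (l - k)%N => // i IH x.
by move=> /(LSplus_subset n0 (@convex_LSplus_iter _ G _)) /IH.
Qed.

Lemma LSplus_iter_FRAC n (G : sgraph n) k :
  (0 < n)%N -> LSplus_iter (R := R) k G `<=` FRAC G.
Proof. by move=> n0; apply: (@LSplus_iter_subset _ G 0 k). Qed.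

Lemma LSplus_iter_rowsub m n (H : sgraph m) (G : sgraph n) (s : 'I_m -> 'I_n) k x :
  (forall i j, H i j -> G (s i) (s j)) ->
  LSplus_iter (R := R) k G x -> LSplus_iter k H (rowsub s x).
Proof.
move=> sHG; elim: k x => [x [x01 xE]|k IH x]; last exact: LSplus_rowsub.
by split=> [i|i j /sHG Gij]; rewrite !mxE; [apply: x01 | apply: xE].
Qed.

End LSplusIter.

End LSplusTheory.

(** * Upper bounds on the LS_+-rank *)

Section UpperBound.
Variables (R : realType) (n : nat) (G : sgraph n).
Implicit Types (P : set 'cV[R]_n) (S T : {set 'I_n}) (a : 'I_n -> R) (b : R).
Implicit Types (i j u v : 'I_n) (x y : 'cV[R]_n).

Definition closed_nbhd v : {set 'I_n} := [set u | (u == v) || G v u]%SET.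

Definition nbhd_in S v : {set 'I_n} := [set u in S | G v u]%SET.

Lemma setD_closed_nbhd S v : S :\: closed_nbhd v = S :\ v :\: nbhd_in S v.
Proof.
apply/setP => u; rewrite !inE.
by case: (u \in S); case: (u == v); case: (G v u).
Qed.

Lemma card_setD_closed_nbhd S v :
  v \in S -> #|S| = (#|S :\: closed_nbhd v| + #|nbhd_in S v|).+1.
Proof.
move=> vS; have nbhdE : (S :\ v) :&: nbhd_in S v = nbhd_in S v.
  apply/finset.setIidPr/fintype.subsetP => u; rewrite !inE => /andP[-> Gvu].
  by rewrite andbT; apply: contraTneq Gvu => ->; rewrite adj_irrefl.
rewrite (cardsD1 v S) vS setD_closed_nbhd -(cardsID (nbhd_in S v) (S :\ v)) nbhdE.
by rewrite [in RHS]addnC.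
Qed.

Definition valid_ineq S a b : Prop :=
  forall T, T \subset S -> stable G T -> \sum_(i in T) a i <= b.

Lemma valid_ineq_ge0 S a b : valid_ineq S a b -> 0 <= b.
Proof.
by move=> /(_ finset.set0 (finset.sub0set S) (@stable0 _ G)); rewrite big_set0.
Qed.

Lemma valid_ineq_setD_closed_nbhd S a b v :
  v \in S -> valid_ineq S a b -> valid_ineq (S :\: closed_nbhd v) a (b - a v).
Proof.
move=> vS valid_ab T /fintype.subsetP TS stT.
have Tv i : i \in T -> [/\ i \in S, i != v & ~~ G v i].
  by move=> /TS; rewrite !inE negb_or => /andP[/andP[-> ->] ->].
have vT : v \notin T by apply/negP => /Tv[]; rewrite eqxx.
rewrite lerBrDl -big_setU1 //; apply: valid_ab => [|i j].
  by apply/fintype.subsetP => i; rewrite !inE => /predU1P[->//|/Tv[]].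
rewrite !inE => /predU1P[->|iT] /predU1P[->|jT]; last exact: stT.
- by rewrite adj_irrefl.
- by case: (Tv j jT).
- by rewrite adj_sym; case: (Tv i iT).
Qed.

Definition obeys_STAB P S : Prop :=
  forall a b x, (forall i, i \in S -> 0 <= a i) -> valid_ineq S a b -> P x ->
  \sum_(i in S) a i * x i 0 <= b.

Lemma obeys_STAB_set0 P : obeys_STAB P finset.set0.
Proof. by move=> a b x _ /valid_ineq_ge0 b0 _; rewrite big_set0. Qed.

Lemma obeys_STAB_isolated P S v :
  P `<=` FRAC G -> v \in S -> nbhd_in S v = finset.set0 ->
  obeys_STAB P (S :\ v) -> obeys_STAB P S.
Proof.
move=> PF vS isol obeys a b x a0 valid_ab Px.
have [/(_ v)/andP[_ xv1] _] := PF x Px; have av0 := a0 v vS.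
rewrite (big_setD1 v) //=; suff : \sum_(i in S :\ v) a i * x i 0 <= b - a v by nra.
apply: obeys Px => [i|]; first by rewrite in_setD1 => /andP[_ /a0].
rewrite -[S :\ v]finset.setD0 -isol -setD_closed_nbhd.
exact: valid_ineq_setD_closed_nbhd.
Qed.

Definition leaf_weights a u v i : R := if i == u then a u - a v else a i.

Lemma leaf_weights_notin a u v T :
  u \notin T -> {in T, leaf_weights a u v =1 a}.
Proof. by move=> uT i iT; rewrite /leaf_weights; case: eqP iT uT => // -> ->. Qed.

Lemma valid_ineq_leaf S a b u v :
  v \in S -> nbhd_in S v = [set u]%SET -> valid_ineq S a b ->
  valid_ineq (S :\ v) (leaf_weights a u v) (b - a v).
Proof.
move=> vS leaf valid_ab T TSv stT; have [uT|uT] := boolP (u \in T).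
  have := valid_ab T (fintype.subset_trans TSv (subD1set _ _)) stT.
  rewrite !(big_setD1 u uT) /= {1}/leaf_weights eqxx.
  by rewrite [X in _ -> _ + X <= _](eq_bigr _ (leaf_weights_notin a v _)) ?setD11 //; lra.
rewrite (eq_bigr _ (leaf_weights_notin a v uT)).
apply: (valid_ineq_setD_closed_nbhd vS valid_ab) => //.
by rewrite setD_closed_nbhd leaf subsetD1 TSv.
Qed.

(* The inequality follows from a v times the edge inequality x u + x v <= 1 and
   from a valid inequality that avoids v, and also u if a u <= a v. *)
Lemma obeys_STAB_leaf P S u v :
  P `<=` FRAC G -> v \in S -> nbhd_in S v = [set u]%SET ->
  (forall T, T \proper S -> obeys_STAB P T) -> obeys_STAB P S.
Proof.
move=> PF vS leaf obeys a b x a0 valid_ab Px.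
have /andP[uS Gvu] : (u \in S) && G v u by have /setP/(_ u) := leaf; rewrite !inE eqxx.
have uSv : u \in S :\ v.
  by rewrite in_setD1 uS andbT; apply: contraTneq Gvu => ->; rewrite adj_irrefl.
have [x01 /(_ _ _ Gvu) edge] := PF x Px; have /andP[xu0 _] := x01 u.
have av0 := a0 v vS; have au0 := a0 u uS; have properSv := properD1 vS.
rewrite (big_setD1 v) // (big_setD1 u) //=; have [auv|auv] := lerP (a u) (a v).
  suff : \sum_(i in S :\ v :\ u) a i * x i 0 <= b - a v by nra.
  apply: obeys Px => [|i|]; first exact: sub_proper_trans (subD1set _ _) properSv.
    by rewrite !in_setD1 => /and3P[_ _ /a0].
  by rewrite -leaf -setD_closed_nbhd; apply: valid_ineq_setD_closed_nbhd.
suff : \sum_(i in S :\ v) leaf_weights a u v i * x i 0 <= b - a v.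
  rewrite (big_setD1 u) //= {1}/leaf_weights eqxx.
  under eq_bigr => i iS do rewrite (leaf_weights_notin _ _ _ iS) ?setD11 //.
  by nra.
apply: obeys (valid_ineq_leaf vS leaf valid_ab) Px => // i.
rewrite in_setD1 /leaf_weights => /andP[_ /a0]; case: eqP => // _ _.
by rewrite subr_ge0 ltW.
Qed.

Lemma obeys_STAB_link P S v a b x :
  P `<=` FRAC G -> v \in S -> obeys_STAB P (S :\: closed_nbhd v) ->
  (forall i, i \in S -> 0 <= a i) -> valid_ineq S a b -> P x -> x v 0 = 1 ->
  \sum_(i in S) a i * x i 0 <= b.
Proof.
move=> PF vS obeys a0 valid_ab Px xv; have [x01 xE] := PF x Px.
rewrite (big_setID (closed_nbhd v)) /= (big_setD1 v) /=; last by rewrite !inE eqxx vS.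
rewrite xv mulr1 big1 => [|i]; last first.
  rewrite !inE => /and3P[/negPf -> _ /= Gvi]; have /andP[xi0 _] := x01 i.
  suff -> : x i 0 = 0 by rewrite mulr0.
  by have := xE _ _ Gvi; lra.
rewrite addr0 -lerBrDl; apply: obeys Px => [i|]; first by rewrite inE => /andP[_ /a0].
exact: valid_ineq_setD_closed_nbhd.
Qed.

Lemma LSplus_hat_sqr_le P (Y : 'M[R]_(1 + n)) x S a :
  LSplus_hat P Y -> col (lshift n 0) Y = homog x ->
  (\sum_(i in S) a i * x i 0) ^+ 2 <=
    \sum_(i in S) a i * \sum_(j in S) a j * Y (rshift 1 j) (rshift 1 i).
Proof.
move=> /LSplus_hatP[psdY _ _ _] Yx.
pose w : 'cV[R]_(1 + n) := col_mx 0 (\col_i (if i \in S then a i else 0)).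
have dot_w z : dot w z = \sum_(i in S) a i * z (rshift 1 i) 0.
  rewrite dotE big_split_ord big_ord1 /= col_mxEu mxE mul0r add0r [RHS]big_mkcond.
  by apply: eq_bigr => i _; rewrite col_mxEd mxE; case: ifP; rewrite ?mul0r.
have Yw p : (Y *m w) p 0 = dot w (col p Y).
  rewrite dotE mxE; apply: eq_bigr => q _.
  by rewrite mulrC -[in LHS]psdY.1 !mxE.
have Ye0 : Y *m e0 R n = homog x by rewrite -colE.
have dot_e0 : dot (e0 R n) (homog x) = 1.
  by rewrite dotC /dot -colE !mxE homog0.
have := sym_psd_cauchy_schwarz (e0 R n) w psdY; rewrite Ye0 dot_e0 mul1r !dot_w.
under eq_bigr do rewrite homogS.
by under [X in _ <= X]eq_bigr do (rewrite Yw dot_w; under eq_bigr do rewrite mxE).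
Qed.

Lemma obeys_STAB_LSplus P S :
  P `<=` FRAC G -> (forall i, i \in S -> obeys_STAB P (S :\: closed_nbhd i)) ->
  obeys_STAB (LSplus P) S.
Proof.
move=> PF obeys a b x a0 valid_ab /LSplusP[Y hatY Yx].
have /LSplus_hatP[[symY _] Y0 cY _] := hatY.
have Yi0 i : Y (rshift 1 i) (lshift n 0) = x i 0.
  by have /colP/(_ (rshift 1 i)) := Yx; rewrite mxE homogS.
have col_le i : i \in S ->
    \sum_(j in S) a j * Y (rshift 1 j) (rshift 1 i) <= b * x i 0.
  move=> iS; have /coneE[c [z [c0 Pz /colP colE]]] := cY i.
  have YiE j : Y (rshift 1 j) (rshift 1 i) = c * z j 0.
    by have := colE (rshift 1 j); rewrite !mxE homogS.
  have xi : x i 0 = c.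
    by have := colE (lshift n 0); rewrite !mxE homog0 mulr1 -[Y]symY mxE Yi0.
  rewrite xi; under eq_bigr do rewrite YiE mulrCA.
  rewrite -mulr_sumr mulrC; have [->|c_neq0] := eqVneq c 0; first by rewrite !mulr0.
  rewrite ler_wpM2r //; apply: (obeys_STAB_link PF iS (obeys i iS)) => //.
  by apply: (mulfI c_neq0); rewrite mulr1 -YiE -Y0 Yi0.
set t := \sum_(i in S) _; have : t ^+ 2 <= b * t.
  apply: le_trans (LSplus_hat_sqr_le S a hatY Yx) _; rewrite mulr_sumr.
  by apply: ler_sum => i iS; rewrite mulrCA ler_wpM2l ?a0 ?col_le.
have b0 := valid_ineq_ge0 valid_ab; have [t0 _|t0] := lerP t 0; first exact: le_trans b0.
by rewrite expr2 ler_pM2r.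
Qed.

Lemma obeys_STAB_min_degree P N :
  P `<=` FRAC G ->
  (forall S, (#|S| <= N)%N -> (forall v, v \in S -> (1 < #|nbhd_in S v|)%N) ->
    obeys_STAB P S) ->
  forall S, (#|S| <= N)%N -> obeys_STAB P S.
Proof.
move=> PF obeys_core S; have [m] := ubnP #|S|; elim: m S => // m IH S Sm SN.
have IHproper T : T \proper S -> obeys_STAB P T.
  by move=> /proper_card TS; apply: IH; lia.
have [v /andP[vS deg_v]|no_low] := pickP (fun v => (v \in S) && (#|nbhd_in S v| <= 1)%N).
  case: (posnP #|nbhd_in S v|) => [/cards0_eq isol|deg_v0].
    exact: obeys_STAB_isolated isol (IHproper _ (properD1 vS)).
  have /eqP/cards1P[u leaf] : #|nbhd_in S v| = 1%N by lia.
  exact: obeys_STAB_leaf leaf IHproper.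
by apply: obeys_core => // v vS; have := no_low v; rewrite vS /= ltnNge => ->.
Qed.

Lemma obeys_STAB_LSplus_iter k S :
  (#|S| <= 3 * k + 2)%N -> obeys_STAB (LSplus_iter k G) S.
Proof.
have [->|[w wS]] := set_0Vmem S; first by move=> _; apply: obeys_STAB_set0.
have n0 : (0 < n)%N by apply: leq_ltn_trans (ltn_ord w).
elim: k S {w wS} => [|k IH]; apply: obeys_STAB_min_degree.
- exact: LSplus_iter_FRAC.
- move=> S S2 deg; have [->|[v vS]] := set_0Vmem S; first exact: obeys_STAB_set0.
  by have := deg v vS; have := card_setD_closed_nbhd vS; lia.
- exact: LSplus_iter_FRAC.
move=> S Sk deg; apply: obeys_STAB_LSplus => [|v vS]; first exact: LSplus_iter_FRAC.
by apply: IH; have := deg v vS; have := card_setD_closed_nbhd vS; lia.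
Qed.

(* Only nonnegative coefficients are needed: replacing a coefficient by its
   positive part keeps an inequality valid, since stable sets are closed under
   taking subsets. *)
Lemma STAB_of_obeys x :
  (forall i, 0 <= x i 0) -> obeys_STAB [set x] [set: 'I_n]%SET -> STAB G x.
Proof.
move=> x0 obeys.
pose us := [seq homog (incidence R T) | T : {set 'I_n} <- enum {set 'I_n}
                                      & `[< stable G T >]].
have us_stable S : stable G S -> homog (incidence R S) \in us.
  by move=> stS; apply: map_f; rewrite mem_filter mem_enum inE andbT; apply/asboolP.
apply/cone_homog; apply: (farkas (us := us) (convex_cone_cone_STAB R G)).
- exact: cone_STAB0.
- move=> u /mapP[S]; rewrite mem_filter => /andP[/asboolP stS _] ->.
  exact: cone_STAB_incidence.
move=> y y_us; pose a i := Num.max (y (rshift 1 i) 0) 0; rewrite dot_homog.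
have le_a : \sum_i y (rshift 1 i) 0 * x i 0 <= \sum_i a i * x i 0.
  by apply: ler_sum => i _; rewrite ler_wpM2r // le_max lexx.
suff : \sum_(i in [set: 'I_n]%SET) a i * x i 0 <= - y (lshift n 0) 0.
  by rewrite (eq_bigl predT) => [|i]; [lra | rewrite finset.in_setT].
apply: obeys => [i _|S _ stS|//]; first by rewrite le_max lexx orbT.
pose T := [set i in S | 0 <= y (rshift 1 i) 0]%SET.
have /us_stable/y_us : stable G T.
  by apply: stable_sub stS; apply/fintype.subsetP => i; rewrite inE => /andP[].
rewrite dot_homog.
suff -> : \sum_(i in S) a i = \sum_i y (rshift 1 i) 0 * incidence R T i 0 by lra.
rewrite big_mkcond; apply: eq_bigr => i _; rewrite mxE inE /a.
by case: (i \in S) => /=; rewrite ?mulr0 //; case: leP; rewrite ?mulr0 ?mulr1.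
Qed.

Theorem LSplus_iter_STAB k : (n <= 3 * k + 2)%N -> LSplus_iter k G = STAB (R := R) G.
Proof.
move=> nk; apply/seteqP; split=> [x xk|]; last exact: STAB_subset_LSplus_iter.
apply: STAB_of_obeys => [i|a b _ a0 valid_ab ->].
  have n0 : (0 < n)%N by apply: leq_ltn_trans (ltn_ord i).
  by have [/(_ i)/andP[]] := LSplus_iter_FRAC n0 xk.
by apply: (obeys_STAB_LSplus_iter (k := k)) xk => //; rewrite cardsT card_ord.
Qed.

End UpperBound.

(** * Exact arithmetic *)

Section IntegerTables.
Variable R : realType.
Implicit Types (M : seq (seq Z)) (m i j : nat).

Definition ZtoR : Z -> R := intr \o int_of_Z.
HB.instance Definition _ := GRing.RMorphism.copy ZtoR (intr \o int_of_Z).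

Lemma ler_ZtoR : {mono ZtoR : x y / x <= y}.
Proof. by move=> x y; rewrite /ZtoR /= ler_int; lia. Qed.

Lemma ltr_ZtoR : {mono ZtoR : x y / x < y}.
Proof. exact: leW_mono ler_ZtoR. Qed.

Lemma ZtoR_ge0 x : (0 <= ZtoR x) = (0 <= x).
Proof. by rewrite -(rmorph0 ZtoR) ler_ZtoR. Qed.

Lemma ZtoR_gt0 x : (0 < ZtoR x) = (0 < x).
Proof. by rewrite -(rmorph0 ZtoR) ltr_ZtoR. Qed.

Definition entry M i j : Z := nth 0 (nth [::] M i) j.

Definition table m (f : nat -> nat -> Z) : seq (seq Z) :=
  mkseq (fun i => mkseq (f i) m) m.

Definition symmetric_table m (upper : seq (seq Z)) : seq (seq Z) :=
  table m (fun i j => nth 0 (nth [::] upper (minn i j)) (maxn i j - minn i j)).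

Definition seqcol n (v : seq Z) : 'cV[R]_n := \col_i ZtoR (nth 0 v i).

Definition seqmx n M : 'M[R]_n := \matrix_(i, j) ZtoR (entry M i j).

Lemma entry_table m f i j : (i < m)%N -> (j < m)%N -> entry (table m f) i j = f i j.
Proof. by move=> im jm; rewrite /entry /table !nth_mkseq. Qed.

(* Fraction-free (Bareiss) elimination: [prev] is the previous nonzero pivot,
   by which the Schur complement is exactly divisible. *)
Fixpoint bareiss_psd m (prev : Z) M : bool :=
  if m isn't m'.+1 then true else
  let p := entry M 0 0 in
  if p == 0 then
    all (fun j => entry M 0 j == 0) (iota 1 m') &&
    bareiss_psd m' prev (table m' (fun i j => entry M i.+1 j.+1))
  else
    let U := table m' (fun i j =>
      p * entry M i.+1 j.+1 - entry M i.+1 0 * entry M 0 j.+1) in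
    let Q := [seq [seq Z.div x prev | x <- r] | r <- U] in
    [&& 0 < p, U == table m' (fun i j => prev * entry Q i j) & bareiss_psd m' p Q].

Lemma seqmx_sym m M : (seqmx m M)^T = seqmx m M <->
  forall i j : 'I_m, ZtoR (entry M i j) = ZtoR (entry M j i).
Proof.
split=> [/matrixP symM i j|symM]; last by apply/matrixP => i j; rewrite !mxE.
by have := symM j i; rewrite !mxE.
Qed.

Lemma bareiss_psd_sound m prev M : 0 < prev -> (seqmx m M)^T = seqmx m M ->
  bareiss_psd m prev M -> sym_psd (seqmx m M).
Proof.
elim: m prev M => [|m IH] prev M prev0 symM /=.
  by split=> // z; rewrite mxE big_ord0.
have entryC := (seqmx_sym _ _).1 symM.
pose A : 'M[R]_(1 + m) := seqmx m.+1 M; set p := entry M 0 0.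
have [p0 /andP[/allP row0] psdM|_ /and3P[p0 /eqP UQ psdQ]] := eqVneq p 0.
  set D := table m _ in psdM; have drD : drsubmx A = seqmx m D.
    by apply/matrixP => i j; rewrite !mxE entry_table.
  apply: (@sym_psd_zero_row _ _ A) => // [j|].
    case: j => [[|j] jm]; rewrite mxE ?[entry _ _ _]p0 ?rmorph0 //=.
    by rewrite (eqP (row0 j.+1 _)) ?rmorph0 // mem_iota add1n.
  rewrite drD; apply: (IH prev) => //; rewrite -drD; apply/matrixP => i j.
  by rewrite !mxE; apply: (entryC (lift ord0 j) (lift ord0 i)).
set U := table m _ in UQ psdQ; set Q := [seq _ | _ <- _] in UQ psdQ.
have QE (i j : 'I_m) : ZtoR prev * ZtoR (entry Q i j) =
    ZtoR p * ZtoR (entry M i.+1 j.+1) - ZtoR (entry M i.+1 0) * ZtoR (entry M 0 j.+1).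
  by rewrite -rmorphM -(@entry_table m (fun i j => prev * entry Q i j)) // -UQ
    entry_table // rmorphB !rmorphM.
have prev_gt0 : 0 < ZtoR prev by rewrite ZtoR_gt0.
apply: (@sym_psd_schur _ _ A) => //; first by rewrite mxE ZtoR_gt0.
have -> : A (lshift m 0) (lshift m 0) *: drsubmx A - dlsubmx A *m ursubmx A =
    ZtoR prev *: seqmx m Q.
  by apply/matrixP => i j; rewrite !mxE QE big_ord1 !mxE.
apply: (convex_cone_sym_psd _ _).2; first exact: ltW.
apply: (IH p) => //; apply/seqmx_sym => i j; apply: (mulfI (lt0r_neq0 prev_gt0)).
rewrite !QE (entryC (lift ord0 i) (lift ord0 j)) mulrC [X in _ - X]mulrC.
by rewrite (entryC ord0 (lift ord0 j)) (entryC ord0 (lift ord0 i)).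
Qed.

End IntegerTables.

(** * Integer certificates for membership in LS_+^k *)

Section IntegerCertificates.
Variables (R : realType) (n : nat) (G : sgraph n) (E : seq ('I_n * 'I_n)).
Hypothesis adjE : forall i j, G i j = ((i, j) \in E) || ((j, i) \in E).
Implicit Types (v w : seq Z) (M : seq (seq Z)) (P : set 'cV[R]_n).

(* Entry 0 of an integer vector is the homogenizing coordinate and entry i.+1
   belongs to the vertex i. *)
Local Notation vec := (seqcol R (1 + n)).

Lemma seqcol0 v : vec v (lshift n 0) 0 = ZtoR R (nth 0 v 0).
Proof. by rewrite mxE. Qed.

Lemma seqcolS v (i : 'I_n) : vec v (rshift 1 i) 0 = ZtoR R (nth 0 v i.+1).
Proof. by rewrite mxE. Qed.

Lemma mem_iotaS (i : 'I_n) : i.+1 \in iota 1 n.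
Proof. by rewrite mem_iota /= add1n ltnS. Qed.

Definition in_cone_FRAC v : bool :=
  let v0 := nth 0 v 0 in
  [&& 0 <= v0, all (fun i => 0 <= nth 0 v i <= v0) (iota 1 n)
    & all (fun e : 'I_n * 'I_n => nth 0 v e.1.+1 + nth 0 v e.2.+1 <= v0) E].

Lemma in_cone_FRAC_sound v : in_cone_FRAC v -> cone (FRAC G) (vec v).
Proof.
move=> /and3P[v0 /allP v_bound /allP v_edge]; apply: cone_FRAC_of_ineqs.
rewrite seqcol0 ZtoR_ge0; split=> // [i|i j].
  by rewrite seqcolS ZtoR_ge0 ler_ZtoR; apply/v_bound/mem_iotaS.
rewrite !seqcolS -rmorphD ler_ZtoR adjE => /orP[/v_edge|/v_edge] //=.
by rewrite addrC.
Qed.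

Definition stable_comb (l : seq (Z * seq 'I_n)) : seq Z :=
  mkseq (fun i => foldr (fun wS c =>
    (if (i == 0%N) || (i.-1 \in map val wS.2) then wS.1 else 0) + c) 0 l) n.+1.

Definition is_stable_comb (l : seq (Z * seq 'I_n)) : bool :=
  all (fun wS => (0 <= wS.1) && all (fun i => all (fun j => ~~ G i j) wS.2) wS.2) l.

Lemma is_stable_comb_sound l : is_stable_comb l -> cone (STAB G) (vec (stable_comb l)).
Proof.
have [coneD coneZ] := convex_cone_cone_STAB R G.
elim: l => [_|[w S] l IH /= /andP[/andP[w0 /allP stS] /IH {}IH]].
  suff -> : vec (stable_comb [::]) = 0.
    exact: cone_STAB0.
  by apply/colP => i; rewrite !mxE nth_mkseq // rmorph0.
have stable_S : stable G [set i in S]%SET.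
  by move=> i j; rewrite !inE => /stS/allP/[apply].
have -> : vec (stable_comb ((w, S) :: l)) =
    ZtoR R w *: homog (incidence R [set i in S]%SET) + vec (stable_comb l).
  apply: colP_homog => [|i]; rewrite [RHS]mxE [X in X + _]mxE ?homog0 ?homogS !mxE.
    by rewrite !nth_mkseq //= rmorphD mulr1.
  rewrite !nth_mkseq ?add1n ?ltnS //= rmorphD inE (mem_map val_inj).
  by case: (i \in S); rewrite ?mulr1 ?mulr0 ?rmorph0.
apply: coneD => //; apply: coneZ; last exact: cone_STAB_incidence.
by rewrite ZtoR_ge0.
Qed.

Definition is_endomorphism (s : seq 'I_n) : bool :=
  (size s == n) && all (fun e => G (nth e.1 s e.1) (nth e.2 s e.2)) E.

Definition pullback (s : seq 'I_n) v : seq Z :=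
  nth 0 v 0 :: [seq nth 0 v i.+1 | i : 'I_n <- s].

Lemma pullback_sound k s v : is_endomorphism s ->
  cone (LSplus_iter k G) (vec v) -> cone (LSplus_iter k G) (vec (pullback s v)).
Proof.
move=> /andP[/eqP size_s /allP s_edge]; pose f i := nth i s i.
have f_hom i j : G i j -> G (f i) (f j).
  by rewrite adjE => /orP[/s_edge|/s_edge] //=; rewrite adj_sym.
move=> /(cone_rowsub (fun x => @LSplus_iter_rowsub R _ _ G G f k x f_hom)).
suff -> : rowsub (homog_map f) (vec v) = vec (pullback s v) by [].
apply: colP_homog => [|i]; rewrite mxE ?homog_map0 ?homog_mapS !mxE //=.
by rewrite add0n (nth_map i) ?size_s.
Qed.

Definition is_pullback (ss : seq (seq 'I_n)) (ws : seq (seq Z)) v : bool :=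
  has (fun w => has (fun s => v == pullback s w) ss) ws.

Definition column_complement M i : seq Z :=
  mkseq (fun j => entry M 0 j - entry M i j) n.+1.

(* If column i vanishes or equals column 0, then the other of the two columns to
   be tested equals column 0; that one lies in the convex cone as soon as a
   column and its complement do. *)
Definition is_LSplus_matrix (accept : pred (seq Z)) M : bool :=
  let column := nth [::] M in
  let complement := column_complement M in
  let accept_or_column0 v := accept v || (v == column 0%N) in
  [&& M == table n.+1 (fun i j => entry M j i), 0 < entry M 0 0, bareiss_psd n.+1 1 M,
      all (fun i => entry M i 0 == entry M i i) (iota 0 n.+1),
      has (fun i => accept (column i) && accept (complement i)) (iota 1 n)
    & all (fun i => accept_or_column0 (column i) && accept_or_column0 (complement i))
        (iota 1 n)].

Lemma is_LSplus_matrix_sound P (accept : pred (seq Z)) M : convex_set P ->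
  (forall v, accept v -> cone P (vec v)) -> is_LSplus_matrix accept M ->
  cone (LSplus P) (vec (nth [::] M 0)).
Proof.
move=> cvxP accept_sound /and5P[/eqP symM M00 psdM /allP diagM].
move=> /andP[/hasP[i0 _ /andP[accept_col accept_compl]] /allP acceptM].
have [coneD _] := convex_cone_cone cvxP; pose Y := seqmx R (1 + n) M.
have symY : Y^T = Y.
  by apply/matrixP => i j; rewrite !mxE {2}symM entry_table.
have colY (i : 'I_(1 + n)) : col i Y = vec (nth [::] M i).
  by rewrite -symY; apply/colP => j; rewrite !mxE.
have complY i : vec (nth [::] M 0) - vec (nth [::] M i) = vec (column_complement M i).
  by apply/colP => j; rewrite !mxE nth_mkseq // rmorphB.
have cone0 : cone P (vec (nth [::] M 0)).
  rewrite -(subrK (vec (nth [::] M i0)) (vec _)) complY.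
  by apply: coneD; apply: accept_sound.
have {accept_sound}accept_or_column0_sound v :
    accept v || (v == nth [::] M 0) -> cone P (vec v).
  by case/orP => [/accept_sound|/eqP->].
rewrite -[vec _](colY (lshift n 0)); apply: cone_LSplus => //; last first.
  by rewrite mxE ZtoR_gt0.
apply/LSplus_hatP; split=> [|i|i|i].
- exact: bareiss_psd_sound ltr01 symY psdM.
- by rewrite !mxE; congr (ZtoR R _); apply/eqP/diagM; rewrite mem_iota /=.
- have /andP[accept_i _] := acceptM _ (mem_iotaS i).
  by rewrite colY; apply: accept_or_column0_sound.
- have /andP[_ accept_i] := acceptM _ (mem_iotaS i).
  by rewrite !colY complY; apply: accept_or_column0_sound.
Qed.

Definition certified k (vs : seq (seq Z)) : Prop :=
  forall v, v \in vs -> cone (LSplus_iter k G) (vec v).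

Lemma certified1 Ms :
  all (is_LSplus_matrix in_cone_FRAC) Ms -> certified 1 (map (head [::]) Ms).
Proof.
move=> /allP Ms_ok _ /mapP[M /Ms_ok M_ok ->]; rewrite -nth0.
exact: is_LSplus_matrix_sound (@convex_FRAC R _ G) in_cone_FRAC_sound M_ok.
Qed.

Lemma certifiedS k ss ls vs Ms :
  all is_endomorphism ss -> all is_stable_comb ls -> certified k vs ->
  all (is_LSplus_matrix (is_pullback ss (map stable_comb ls ++ vs))) Ms ->
  certified k.+1 (map (head [::]) Ms).
Proof.
move=> /allP ss_ok /allP ls_ok vs_ok /allP Ms_ok _ /mapP[M /Ms_ok M_ok ->].
rewrite -nth0; apply: is_LSplus_matrix_sound M_ok; first exact: convex_LSplus_iter.
move=> _ /hasP[w w_in /hasP[s /ss_ok s_ok /eqP->]]; apply: pullback_sound => //.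
move: w_in; rewrite mem_cat => /orP[/mapP[l /ls_ok l_ok ->]|/vs_ok//].
exact: cone_subset (@STAB_subset_LSplus_iter R _ G k) _ (is_stable_comb_sound l_ok).
Qed.

End IntegerCertificates.

(** * Stability number *)

Section StabilityNumber.
Variables (n : nat) (G : sgraph n).

Fixpoint stability_number_le m (allowed : pred 'I_n) (vs : seq 'I_n) : bool :=
  if vs isn't v :: vs' then true else
  stability_number_le m allowed vs' &&
  (allowed v ==>
   if m isn't m'.+1 then false else
   stability_number_le m' [pred u | allowed u && ~~ G v u] vs').

Lemma stability_number_le_count m (allowed : pred 'I_n) vs (S : {set 'I_n}) :
  stability_number_le m allowed vs -> stable G S -> {subset S <= allowed} ->
  (count (mem S) vs <= m)%N.
Proof.
elim: vs m allowed => // v vs IH m allowed /= /andP[without_v with_v] stS S_allowed.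
case: (boolP (v \in S)) => [vS|_]; last exact: IH without_v _ _.
move: with_v; rewrite [allowed v]S_allowed //; case: m {without_v} => //= m with_v.
rewrite ltnS; apply: IH with_v _ _ => // u uS.
by rewrite inE; apply/andP; split; [apply: S_allowed | apply: stS].
Qed.

Lemma stability_number_le_card m vs (S : {set 'I_n}) :
  stability_number_le m xpredT vs -> (forall v, v \in vs) -> stable G S ->
  (#|S| <= m)%N.
Proof.
move=> m_ok vs_all stS; apply: leq_trans (stability_number_le_count m_ok stS _) => //.
rewrite cardE -size_filter; apply: uniq_leq_size (enum_uniq _) _ => v.
by rewrite mem_enum mem_filter vs_all andbT.
Qed.

Lemma STAB_sum_le (R : realType) m (x : 'cV[R]_n) :
  (forall S, stable G S -> (#|S| <= m)%N) -> STAB G x -> \sum_i x i 0 <= m%:R.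
Proof.
move=> card_le; pose P : set 'cV[R]_n := [set y | \sum_i y i 0 <= m%:R].
apply: (convex_hull_subset (P := P)) => [|_ [S stS ->]].
  apply/convex_setP => y z a /andP[a0 a1]; rewrite /P /= => ym zm.
  under eq_bigr do rewrite !mxE.
  by rewrite big_split /= -!mulr_sumr; nra.
rewrite /P /=; under eq_bigr do rewrite mxE.
by rewrite -natr_sum ler_nat -big_mkcond sum1_card card_le.
Qed.

Lemma cone_STAB_sum_le (R : realType) m (u : 'cV[R]_(1 + n)) :
  (forall S, stable G S -> (#|S| <= m)%N) -> cone (STAB G) u ->
  \sum_i u (rshift 1 i) 0 <= m%:R * u (lshift n 0) 0.
Proof.
move=> card_le /coneE[a [x [a0 /(STAB_sum_le card_le) xm ->]]].
under eq_bigr do rewrite mxE homogS.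
by rewrite -mulr_sumr mxE homog0 mulr1 mulrC ler_wpM2r.
Qed.

End StabilityNumber.

(** * The graph G_{4,1} *)

Definition G41_automorphisms : seq (seq 'I_12) := [::
  [:: v1; v2; v3; v4_0; v4_1; v4_2; v5_0; v5_1; v5_2; v6_0; v6_1; v6_2];
  [:: v1; v3; v2; v5_0; v5_2; v5_1; v4_0; v4_2; v4_1; v6_0; v6_2; v6_1];
  [:: v2; v1; v3; v6_0; v6_2; v6_1; v5_0; v5_2; v5_1; v4_0; v4_2; v4_1];
  [:: v2; v3; v1; v5_0; v5_1; v5_2; v6_0; v6_1; v6_2; v4_0; v4_1; v4_2];
  [:: v3; v1; v2; v6_0; v6_1; v6_2; v4_0; v4_1; v4_2; v5_0; v5_1; v5_2];
  [:: v3; v2; v1; v4_0; v4_2; v4_1; v6_0; v6_2; v6_1; v5_0; v5_2; v5_1]].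

(* Numerical data, obtained by rounding a strictly feasible solution of the
   semidefinite program maximizing the sum of x over symmetric x in LS_+^3 and
   scaled by 20000; the sum attained here is 80010/20000. A pair (w, S)
   is w times the incidence vector of S; matrices are given by the rows of their
   upper triangles, each row starting at the diagonal. *)
Local Open Scope Z_scope.

Definition stable_combinations : seq (seq (Z * seq 'I_12)) := [::
  [::];
  [:: (2025, [:: v1; v4_0; v5_0; v6_0]); (1562, [:: v1; v4_2; v5_0; v6_0]);
      (1562, [:: v1; v4_0; v5_1; v6_0]); (1, [:: v1; v4_0; v5_0])];
  [:: (2025, [:: v2; v4_0; v5_0; v6_0]); (1477, [:: v2; v4_0; v5_2; v6_0]);
      (1644, [:: v2; v4_0; v5_0; v6_1]); (1, [:: v2; v4_0; v5_0]); (2, [:: v2; v4_0; v6_0]);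
      (1, [:: v2; v5_0; v6_0])];
  [:: (1294, [:: v3; v4_1; v5_0; v6_0]); (1472, [:: v4_1; v4_2; v5_0; v6_0]);
      (85, [:: v4_1; v4_2; v5_1; v6_0]); (55, [:: v4_2; v5_1; v5_2; v6_0]);
      (141, [:: v3; v4_1; v5_0; v6_2]); (136, [:: v4_1; v5_0; v6_1; v6_2]);
      (4, [:: v3; v4_1; v5_0]); (4, [:: v3; v4_1; v6_0]); (1, [:: v2; v5_0; v6_0]);
      (36, [:: v3; v5_0; v6_0]); (38, [:: v4_1; v5_0; v6_0])];
  [:: (1330, [:: v3; v4_1; v5_0; v6_0]); (1507, [:: v4_1; v4_2; v5_0; v6_0]);
      (52, [:: v4_1; v4_2; v5_1; v6_0]); (141, [:: v3; v4_1; v5_0; v6_2]);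
      (133, [:: v4_1; v5_0; v6_1; v6_2]); (3, [:: v3; v4_1; v5_0]);
      (3, [:: v3; v4_1; v6_0]); (5, [:: v4_1; v5_0; v6_0])];
  [:: (1469, [:: v4_1; v4_2; v5_0; v6_0]); (87, [:: v4_1; v4_2; v5_1; v6_0]);
      (52, [:: v4_2; v5_1; v5_2; v6_0]); (2, [:: v4_1; v4_2; v5_0]);
      (1, [:: v4_1; v4_2; v6_0]); (1, [:: v4_2; v5_0; v6_0])];
  [:: (1358, [:: v2; v4_0; v5_0; v6_1]); (275, [:: v2; v4_0; v5_2; v6_1]);
      (1362, [:: v3; v4_0; v5_0; v6_2]); (277, [:: v3; v4_1; v5_0; v6_2]);
      (1535, [:: v4_0; v5_0; v6_1; v6_2]); (6, [:: v2; v4_0; v5_0]);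
      (6, [:: v3; v4_0; v5_0]); (2, [:: v4_2; v5_1; v5_2]); (4, [:: v2; v4_0; v6_1]);
      (2, [:: v2; v5_0; v6_1])];
  [:: (1364, [:: v2; v4_0; v5_0; v6_1]); (274, [:: v2; v4_0; v5_2; v6_1]);
      (1392, [:: v4_0; v5_0; v6_1; v6_2]); (133, [:: v4_1; v5_0; v6_1; v6_2]);
      (3, [:: v2; v4_0; v6_1]); (3, [:: v2; v5_0; v6_1]); (5, [:: v4_0; v5_0; v6_1])];
  [:: (1951, [:: v1; v4_0; v5_0; v6_0]); (1635, [:: v1; v4_0; v5_1; v6_0]);
      (1, [:: v1; v4_0; v5_0]); (1, [:: v1; v4_0; v6_0])];
  [:: (2147, [:: v2; v4_0; v5_0; v6_0]); (1500, [:: v2; v4_0; v5_2; v6_0]);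
      (1500, [:: v2; v4_0; v5_0; v6_1]); (1, [:: v2; v4_0; v5_0]); (1, [:: v2; v4_0; v6_0])];
  [:: (1596, [:: v1; v4_0; v5_1; v6_0]); (1486, [:: v2; v4_0; v5_2; v6_0]);
      (1478, [:: v4_0; v5_1; v5_2; v6_0]); (2, [:: v2; v4_0; v5_2; v6_1]);
      (134, [:: v4_0; v5_2; v6_1; v6_2]); (26, [:: v1; v4_0; v5_1]);
      (14, [:: v1; v4_0; v6_0]); (13, [:: v2; v4_0; v6_0]); (1, [:: v3; v4_0; v6_0])];
  [:: (1634, [:: v1; v4_0; v5_1; v6_0]); (1331, [:: v4_0; v5_1; v5_2; v6_0]);
      (133, [:: v4_0; v5_1; v5_2; v6_1]); (1, [:: v1; v4_0; v5_1]);
      (1, [:: v4_0; v5_1; v6_0])];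
  [:: (1497, [:: v2; v4_0; v5_2; v6_0]); (1464, [:: v4_0; v5_1; v5_2; v6_0]);
      (133, [:: v4_0; v5_2; v6_1; v6_2]); (3, [:: v2; v4_0; v5_2]);
      (3, [:: v4_0; v5_2; v6_0])];
  [:: (1537, [:: v3; v4_1; v5_0; v6_0]); (1545, [:: v1; v4_2; v5_0; v6_0]);
      (1555, [:: v4_1; v4_2; v5_0; v6_0]); (74, [:: v4_2; v5_1; v5_2; v6_0]);
      (74, [:: v4_1; v5_0; v6_1; v6_2]); (4, [:: v3; v4_1; v5_0]); (4, [:: v3; v4_1; v6_0]);
      (17, [:: v1; v5_0; v6_0]); (1, [:: v2; v5_0; v6_0]); (17, [:: v3; v5_0; v6_0])];
  [:: (1556, [:: v3; v4_1; v5_0; v6_0]); (1466, [:: v4_1; v4_2; v5_0; v6_0]);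
      (71, [:: v4_1; v4_2; v5_1; v6_0]); (71, [:: v4_1; v5_0; v6_1; v6_2]);
      (3, [:: v3; v4_1; v5_0]); (3, [:: v3; v4_1; v6_0]); (4, [:: v4_1; v5_0; v6_0])];
  [:: (1964, [:: v1; v4_0; v5_0; v6_0]); (1632, [:: v1; v4_2; v5_0; v6_0]);
      (1548, [:: v1; v4_0; v5_1; v6_0]); (2, [:: v1; v4_0; v5_0]); (2, [:: v1; v4_0; v6_0]);
      (2, [:: v1; v5_0; v6_0])];
  [:: (2120, [:: v2; v4_0; v5_0; v6_0]); (1512, [:: v2; v4_0; v5_2; v6_0]);
      (1512, [:: v2; v4_0; v5_0; v6_1]); (2, [:: v2; v4_0; v5_0]); (2, [:: v2; v4_0; v6_0]);
      (2, [:: v2; v5_0; v6_0])];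
  [:: (1968, [:: v3; v4_0; v5_0; v6_0]); (1614, [:: v3; v4_0; v5_0; v6_2]);
      (2, [:: v3; v4_0; v5_0]); (2, [:: v3; v4_0; v6_0]); (2, [:: v3; v5_0; v6_0])];
  [:: (697, [:: v1; v4_2; v5_0; v6_0]); (912, [:: v1; v4_2; v5_1; v6_0]);
      (4, [:: v4_2; v5_1; v5_2; v6_0]); (3, [:: v1; v4_2; v5_0]); (11, [:: v1; v4_2; v6_0]);
      (11, [:: v1; v5_0; v6_0]); (6, [:: v4_2; v5_0; v6_0]); (2, [:: v2; v5_0; v6_1]);
      (2, [:: v5_1; v5_2; v6_1]); (2, [:: v3; v5_0; v6_2]); (4, [:: v4_2; v5_0; v6_2])];
  [:: (704, [:: v1; v4_2; v5_0; v6_0]); (916, [:: v1; v4_2; v5_1; v6_0]);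
      (5, [:: v1; v4_2; v5_0]); (7, [:: v1; v4_2; v6_0]); (5, [:: v4_2; v5_0; v6_0])];
  [:: (587, [:: v1; v4_0; v5_1; v6_0]); (923, [:: v1; v4_2; v5_1; v6_0]);
      (1486, [:: v2; v4_0; v5_2; v6_0]); (1581, [:: v4_0; v5_1; v5_2; v6_0]);
      (107, [:: v4_0; v5_2; v6_1; v6_2]); (6, [:: v1; v4_0; v5_1]);
      (28, [:: v1; v4_0; v6_0]); (28, [:: v2; v4_0; v6_0]); (2, [:: v3; v4_0; v6_0]);
      (6, [:: v1; v5_1; v6_0])];
  [:: (629, [:: v1; v4_0; v5_1; v6_0]); (916, [:: v1; v4_2; v5_1; v6_0]);
      (1451, [:: v4_0; v5_1; v5_2; v6_0]); (102, [:: v4_0; v5_1; v5_2; v6_1]);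
      (1, [:: v1; v4_0; v5_1]); (2, [:: v1; v5_1; v6_0]); (2, [:: v4_0; v5_1; v6_0])];
  [:: (1501, [:: v2; v4_0; v5_2; v6_0]); (1553, [:: v4_0; v5_1; v5_2; v6_0]);
      (102, [:: v4_0; v5_2; v6_1; v6_2]); (5, [:: v2; v4_0; v5_2]);
      (6, [:: v2; v5_2; v6_0]); (7, [:: v4_0; v5_2; v6_0])];
  [:: (1468, [:: v2; v4_0; v5_0; v6_1]); (6, [:: v2; v4_0; v5_2; v6_1]);
      (96, [:: v4_0; v5_1; v5_2; v6_1]); (1582, [:: v3; v4_0; v5_0; v6_2]);
      (1521, [:: v4_0; v5_0; v6_1; v6_2]); (28, [:: v2; v4_0; v5_0]);
      (34, [:: v3; v4_0; v5_0]); (2, [:: v1; v4_0; v5_1]); (5, [:: v4_2; v5_1; v5_2]);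
      (4, [:: v2; v4_0; v6_1]); (8, [:: v2; v5_0; v6_1])];
  [:: (1503, [:: v2; v4_0; v5_0; v6_1]); (102, [:: v4_0; v5_1; v5_2; v6_1]);
      (1482, [:: v4_0; v5_0; v6_1; v6_2]); (5, [:: v2; v4_0; v6_1]);
      (4, [:: v2; v5_0; v6_1]); (7, [:: v4_0; v5_0; v6_1])];
  [:: (1603, [:: v3; v4_0; v5_0; v6_2]); (1380, [:: v4_0; v5_0; v6_1; v6_2]);
      (102, [:: v4_0; v5_2; v6_1; v6_2]); (5, [:: v3; v4_0; v6_2]);
      (6, [:: v3; v5_0; v6_2]); (7, [:: v4_0; v5_0; v6_2])]].

Definition level1_matrices : seq (seq (seq Z)) := map (symmetric_table 13) [::
  [:: [:: 9700; 0; 0; 5150; 6435; 3174; 1612; 7913; 1612; 1697; 6518; 1530; 3174];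
      [:: 0; 0; 0; 0; 0; 0; 0; 0; 0; 0; 0; 0]; [:: 0; 0; 0; 0; 0; 0; 0; 0; 0; 0; 0];
      [:: 5150; 3960; 1189; 0; 5149; 0; 0; 3966; 0; 1182];
      [:: 6435; 0; 0; 4798; 1463; 1635; 4519; 1048; 1915];
      [:: 3174; 1550; 3113; 59; 0; 1955; 481; 1217]; [:: 1612; 1463; 147; 60; 1105; 0; 506];
      [:: 7913; 0; 0; 4895; 1383; 3017]; [:: 1612; 1551; 1608; 2; 0];
      [:: 1697; 1550; 146; 144]; [:: 6518; 0; 0]; [:: 1530; 1526]; [:: 3174]];
  [:: [:: 11584; 0; 5149; 3671; 11584; 0; 0; 8462; 1472; 3119; 7038; 3038; 2897];
      [:: 0; 0; 0; 0; 0; 0; 0; 0; 0; 0; 0; 0];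
      [:: 5149; 0; 5149; 0; 0; 3947; 0; 1201; 4024; 1124; 0];
      [:: 3671; 3671; 0; 0; 3670; 0; 0; 2408; 0; 1262];
      [:: 11584; 0; 0; 8462; 1472; 3119; 7038; 3038; 2897]; [:: 0; 0; 0; 0; 0; 0; 0; 0];
      [:: 0; 0; 0; 0; 0; 0; 0]; [:: 8462; 0; 0; 5484; 1853; 2171];
      [:: 1472; 1471; 878; 593; 0]; [:: 3119; 1553; 1184; 725]; [:: 7038; 0; 0];
      [:: 3038; 1634]; [:: 2897]];
  [:: [:: 11676; 0; 5150; 3673; 11584; 0; 53; 8465; 1560; 3174; 7126; 3041; 2900];
      [:: 0; 0; 0; 0; 0; 0; 0; 0; 0; 0; 0; 0];
      [:: 5150; 0; 5140; 0; 0; 3964; 0; 1176; 4009; 1132; 0];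
      [:: 3673; 3663; 0; 0; 3664; 0; 0; 2423; 0; 1241];
      [:: 11584; 0; 0; 8454; 1507; 3120; 7072; 3031; 2890]; [:: 0; 0; 0; 0; 0; 0; 0; 0];
      [:: 53; 0; 44; 44; 44; 0; 0]; [:: 8465; 0; 0; 5473; 1895; 2160];
      [:: 1560; 1551; 977; 574; 0]; [:: 3174; 1644; 1137; 731]; [:: 7126; 0; 0];
      [:: 3041; 1650]; [:: 2900]];
  [:: [:: 13238; 0; 5150; 5150; 11584; 1615; 0; 10112; 1473; 3122; 8413; 3174; 3174];
      [:: 0; 0; 0; 0; 0; 0; 0; 0; 0; 0; 0; 0];
      [:: 5150; 0; 5140; 0; 0; 3946; 0; 1202; 4045; 1104; 0];
      [:: 5150; 3868; 1276; 0; 5149; 0; 0; 3791; 0; 1358];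
      [:: 11584; 0; 0; 8483; 1464; 3100; 8013; 2885; 2002];
      [:: 1615; 0; 1614; 0; 0; 389; 279; 1164]; [:: 0; 0; 0; 0; 0; 0; 0];
      [:: 10112; 0; 0; 6819; 2012; 2463]; [:: 1473; 1472; 862; 610; 0];
      [:: 3122; 1593; 1161; 709]; [:: 8413; 0; 0]; [:: 3174; 1815]; [:: 3174]];
  [:: [:: 10023; 0; 3505; 3505; 7038; 2897; 1610; 7038; 1610; 2897; 10023; 0; 0];
      [:: 0; 0; 0; 0; 0; 0; 0; 0; 0; 0; 0; 0];
      [:: 3505; 0; 3504; 0; 0; 2164; 0; 1340; 3505; 0; 0];
      [:: 3505; 2164; 1340; 0; 3504; 0; 0; 3505; 0; 0];
      [:: 7038; 0; 0; 4194; 1470; 2843; 7038; 0; 0];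
      [:: 2897; 1556; 2843; 53; 0; 2897; 0; 0]; [:: 1610; 1470; 139; 53; 1610; 0; 0];
      [:: 7038; 0; 0; 7038; 0; 0]; [:: 1610; 1556; 1610; 0; 0]; [:: 2897; 2897; 0; 0];
      [:: 10023; 0; 0]; [:: 0; 0]; [:: 0]];
  [:: [:: 11676; 0; 3506; 5150; 8546; 3041; 1612; 8687; 1612; 2900; 10023; 0; 1649];
      [:: 0; 0; 0; 0; 0; 0; 0; 0; 0; 0; 0; 0];
      [:: 3506; 0; 3505; 0; 0; 2163; 0; 1342; 3505; 0; 0];
      [:: 5150; 3666; 1483; 0; 5149; 0; 0; 3861; 0; 1288];
      [:: 8546; 0; 0; 5700; 1470; 2845; 8049; 0; 496];
      [:: 3041; 1557; 2986; 54; 0; 1896; 0; 1144]; [:: 1612; 1470; 141; 54; 1255; 0; 356];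
      [:: 8687; 0; 0; 7324; 0; 1362]; [:: 1612; 1557; 1611; 0; 0]; [:: 2900; 2621; 0; 278];
      [:: 10023; 0; 0]; [:: 0; 0]; [:: 1649]];
  [:: [:: 11584; 0; 5149; 3588; 11584; 0; 0; 8470; 1465; 3100; 6835; 3100; 3100];
      [:: 0; 0; 0; 0; 0; 0; 0; 0; 0; 0; 0; 0];
      [:: 5149; 0; 5149; 0; 0; 3970; 0; 1175; 4034; 1111; 0];
      [:: 3588; 3588; 0; 0; 3584; 0; 0; 2206; 0; 1377];
      [:: 11584; 0; 0; 8470; 1465; 3100; 6835; 3100; 3100]; [:: 0; 0; 0; 0; 0; 0; 0; 0];
      [:: 0; 0; 0; 0; 0; 0; 0]; [:: 8470; 0; 0; 5308; 1914; 2354];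
      [:: 1465; 1461; 868; 593; 0]; [:: 3100; 1522; 1181; 741]; [:: 6835; 0; 0];
      [:: 3100; 1718]; [:: 3100]];
  [:: [:: 10023; 3588; 0; 3588; 10023; 0; 0; 6774; 3100; 1600; 6774; 1600; 3100];
      [:: 3588; 0; 0; 3588; 0; 0; 1987; 1600; 0; 3587; 0; 0];
      [:: 0; 0; 0; 0; 0; 0; 0; 0; 0; 0; 0];
      [:: 3588; 3588; 0; 0; 3587; 0; 0; 1987; 0; 1600];
      [:: 10023; 0; 0; 6774; 3100; 1600; 6774; 1600; 3100]; [:: 0; 0; 0; 0; 0; 0; 0; 0];
      [:: 0; 0; 0; 0; 0; 0; 0]; [:: 6774; 0; 0; 3774; 1352; 2999];
      [:: 3100; 1499; 2999; 100; 0]; [:: 1600; 1352; 247; 100]; [:: 6774; 0; 0];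
      [:: 1600; 1499]; [:: 3100]];
  [:: [:: 10422; 1952; 3648; 3587; 10422; 0; 0; 10422; 0; 0; 5834; 2964; 2966];
      [:: 1952; 0; 0; 1952; 0; 0; 1952; 0; 0; 1951; 0; 0];
      [:: 3648; 0; 3648; 0; 0; 3648; 0; 0; 2169; 1478; 0];
      [:: 3587; 3587; 0; 0; 3587; 0; 0; 2106; 0; 1480];
      [:: 10422; 0; 0; 10422; 0; 0; 5834; 2964; 2966]; [:: 0; 0; 0; 0; 0; 0; 0; 0];
      [:: 0; 0; 0; 0; 0; 0; 0]; [:: 10422; 0; 0; 5834; 2964; 2966]; [:: 0; 0; 0; 0; 0];
      [:: 0; 0; 0; 0]; [:: 5834; 0; 0]; [:: 2964; 1485]; [:: 2966]];
  [:: [:: 12072; 1953; 5149; 3588; 12072; 0; 0; 10422; 0; 1636; 7456; 2967; 3100];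
      [:: 1953; 0; 0; 1953; 0; 0; 1949; 0; 0; 1949; 0; 0];
      [:: 5149; 0; 5149; 0; 0; 3829; 0; 1316; 3796; 1348; 0];
      [:: 3588; 3588; 0; 0; 3584; 0; 0; 2102; 0; 1481];
      [:: 12072; 0; 0; 10422; 0; 1636; 7456; 2967; 3100]; [:: 0; 0; 0; 0; 0; 0; 0; 0];
      [:: 0; 0; 0; 0; 0; 0; 0]; [:: 10422; 0; 0; 7013; 1825; 2817]; [:: 0; 0; 0; 0; 0];
      [:: 1636; 439; 1138; 279]; [:: 7456; 0; 0]; [:: 2967; 1614]; [:: 3100]];
  [:: [:: 12072; 3588; 3649; 3588; 12072; 0; 0; 10422; 1636; 0; 7458; 2967; 2967];
      [:: 3588; 0; 0; 3588; 0; 0; 1952; 1632; 0; 3584; 0; 0];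
      [:: 3649; 0; 3649; 0; 0; 3645; 0; 0; 2156; 1489; 0];
      [:: 3588; 3588; 0; 0; 3584; 0; 0; 2095; 0; 1489];
      [:: 12072; 0; 0; 10422; 1636; 0; 7458; 2967; 2967]; [:: 0; 0; 0; 0; 0; 0; 0; 0];
      [:: 0; 0; 0; 0; 0; 0; 0]; [:: 10422; 0; 0; 5822; 2963; 2963];
      [:: 1636; 0; 1632; 0; 0]; [:: 0; 0; 0; 0]; [:: 7458; 0; 0]; [:: 2967; 1474]; [:: 2967]];
  [:: [:: 11676; 0; 5150; 3588; 11656; 0; 5; 8472; 1555; 3174; 6924; 3103; 3103];
      [:: 0; 0; 0; 0; 0; 0; 0; 0; 0; 0; 0; 0];
      [:: 5150; 0; 5147; 0; 0; 3981; 0; 1164; 4008; 1139; 0];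
      [:: 3588; 3585; 0; 0; 3581; 0; 0; 2207; 0; 1377];
      [:: 11656; 0; 0; 8469; 1550; 3169; 6919; 3100; 3100]; [:: 0; 0; 0; 0; 0; 0; 0; 0];
      [:: 5; 0; 2; 2; 2; 0; 0]; [:: 8472; 0; 0; 5296; 1948; 2347];
      [:: 1555; 1549; 962; 590; 0]; [:: 3174; 1621; 1148; 751]; [:: 6924; 0; 0];
      [:: 3103; 1722]; [:: 3103]];
  [:: [:: 11676; 5150; 0; 3588; 10024; 0; 1637; 8436; 3103; 1662; 8436; 1591; 3103];
      [:: 5150; 0; 0; 3872; 0; 1275; 3621; 1527; 0; 5148; 0; 0];
      [:: 0; 0; 0; 0; 0; 0; 0; 0; 0; 0; 0];
      [:: 3588; 3583; 0; 0; 3586; 0; 0; 1988; 0; 1598];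
      [:: 10024; 0; 0; 7926; 1979; 1303; 7083; 1586; 2824]; [:: 0; 0; 0; 0; 0; 0; 0; 0];
      [:: 1637; 505; 1119; 355; 1348; 0; 275]; [:: 8436; 0; 0; 5419; 1370; 3015];
      [:: 3103; 1574; 3015; 86; 0]; [:: 1662; 1441; 220; 86]; [:: 8436; 0; 0];
      [:: 1591; 1503]; [:: 3103]];
  [:: [:: 13238; 5150; 5150; 0; 11586; 0; 1637; 8486; 3103; 3174; 10100; 3103; 1489];
      [:: 5150; 0; 0; 3881; 0; 1264; 3856; 1289; 0; 5141; 0; 0];
      [:: 5150; 0; 5145; 0; 0; 4045; 0; 1100; 3954; 1189; 0];
      [:: 0; 0; 0; 0; 0; 0; 0; 0; 0; 0];
      [:: 11586; 0; 0; 8056; 1963; 2872; 8476; 3098; 1479]; [:: 0; 0; 0; 0; 0; 0; 0; 0];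
      [:: 1637; 425; 1136; 297; 1619; 0; 5]; [:: 8486; 0; 0; 6882; 1595; 876];
      [:: 3103; 1809; 2397; 699; 0]; [:: 3174; 2012; 1152; 609]; [:: 10100; 0; 0];
      [:: 3103; 1476]; [:: 1489]];
  [:: [:: 15172; 3516; 5148; 3586; 15172; 0; 0; 11347; 2185; 3168; 10431; 3099; 3097];
      [:: 3516; 0; 0; 3516; 0; 0; 2975; 512; 0; 3488; 0; 0];
      [:: 5148; 0; 5148; 0; 0; 4250; 0; 869; 4607; 513; 0];
      [:: 3586; 3586; 0; 0; 3558; 0; 0; 2164; 0; 1394];
      [:: 15172; 0; 0; 11347; 2185; 3168; 10431; 3099; 3097]; [:: 0; 0; 0; 0; 0; 0; 0; 0];
      [:: 0; 0; 0; 0; 0; 0; 0]; [:: 11347; 0; 0; 8846; 1489; 2015];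
      [:: 2185; 1644; 761; 1396; 0]; [:: 3168; 1511; 1582; 1054]; [:: 10431; 0; 0];
      [:: 3099; 1675]; [:: 3097]];
  [:: [:: 15189; 3518; 5150; 3588; 15172; 0; 0; 11358; 2187; 3174; 10440; 3103; 3103];
      [:: 3518; 0; 0; 3512; 0; 0; 3023; 469; 0; 3463; 0; 0];
      [:: 5150; 0; 5144; 0; 0; 4048; 0; 1072; 4072; 1045; 0];
      [:: 3588; 3582; 0; 0; 3529; 0; 0; 2235; 0; 1322];
      [:: 15172; 0; 0; 11352; 2181; 3168; 10434; 3097; 3097]; [:: 0; 0; 0; 0; 0; 0; 0; 0];
      [:: 0; 0; 0; 0; 0; 0; 0]; [:: 11358; 0; 0; 8503; 1868; 2264];
      [:: 2187; 1689; 1409; 744; 0]; [:: 3174; 1802; 1148; 802]; [:: 10440; 0; 0];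
      [:: 3103; 1743]; [:: 3103]];
  [:: [:: 12072; 3600; 3636; 3586; 11347; 0; 714; 12072; 0; 0; 7431; 2996; 2996];
      [:: 3600; 0; 0; 2885; 0; 712; 3600; 0; 0; 3598; 0; 0];
      [:: 3636; 0; 3633; 0; 0; 3636; 0; 0; 2138; 1496; 0];
      [:: 3586; 3583; 0; 0; 3586; 0; 0; 2088; 0; 1496];
      [:: 11347; 0; 0; 11347; 0; 0; 6716; 2993; 2993]; [:: 0; 0; 0; 0; 0; 0; 0; 0];
      [:: 714; 714; 0; 0; 712; 0; 0]; [:: 12072; 0; 0; 7431; 2996; 2996];
      [:: 0; 0; 0; 0; 0]; [:: 0; 0; 0; 0]; [:: 7431; 0; 0]; [:: 2996; 1498]; [:: 2996]];
  [:: [:: 13723; 3602; 5150; 3588; 12987; 0; 721; 12072; 0; 1621; 9072; 3001; 3103];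
      [:: 3602; 0; 0; 2881; 0; 717; 3594; 0; 0; 3598; 0; 0];
      [:: 5150; 0; 5146; 0; 0; 3853; 0; 1290; 3767; 1379; 0];
      [:: 3588; 3584; 0; 0; 3579; 0; 0; 2103; 0; 1481];
      [:: 12987; 0; 0; 11360; 0; 1615; 8351; 2997; 3099]; [:: 0; 0; 0; 0; 0; 0; 0; 0];
      [:: 721; 706; 0; 0; 717; 0; 0]; [:: 12072; 0; 0; 8614; 1871; 2797];
      [:: 0; 0; 0; 0; 0]; [:: 1621; 449; 1123; 299]; [:: 9072; 0; 0]; [:: 3001; 1618];
      [:: 3103]];
  [:: [:: 13652; 5150; 3638; 3588; 12004; 0; 1637; 12072; 1550; 0; 9005; 3001; 3001];
      [:: 5150; 0; 0; 3513; 0; 1634; 3598; 1547; 0; 5147; 0; 0];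
      [:: 3638; 0; 3635; 0; 0; 3629; 0; 0; 2145; 1490; 0];
      [:: 3588; 3585; 0; 0; 3579; 0; 0; 2095; 0; 1490];
      [:: 12004; 0; 0; 11984; 0; 0; 7368; 2998; 2998]; [:: 0; 0; 0; 0; 0; 0; 0; 0];
      [:: 1637; 83; 1547; 0; 1634; 0; 0]; [:: 12072; 0; 0; 7451; 2992; 2992];
      [:: 1550; 0; 1547; 0; 0]; [:: 0; 0; 0; 0]; [:: 9005; 0; 0]; [:: 3001; 1508]; [:: 3001]];
  [:: [:: 12072; 5148; 3636; 1972; 10431; 0; 1632; 7431; 3000; 3067; 12072; 0; 0];
      [:: 5148; 0; 0; 3830; 0; 1316; 3730; 1417; 0; 5148; 0; 0];
      [:: 3636; 0; 3634; 0; 0; 2151; 0; 1484; 3636; 0; 0];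
      [:: 1972; 1970; 0; 0; 1970; 0; 0; 1972; 0; 0];
      [:: 10431; 0; 0; 6989; 1865; 2790; 10431; 0; 0]; [:: 0; 0; 0; 0; 0; 0; 0; 0];
      [:: 1632; 439; 1132; 275; 1632; 0; 0]; [:: 7431; 0; 0; 7431; 0; 0];
      [:: 3000; 1582; 3000; 0; 0]; [:: 3067; 3067; 0; 0]; [:: 12072; 0; 0]; [:: 0; 0];
      [:: 0]];
  [:: [:: 13723; 5150; 3638; 3588; 12073; 0; 1637; 9076; 3001; 3072; 12072; 0; 1621];
      [:: 5150; 0; 0; 3840; 0; 1306; 3738; 1408; 0; 5141; 0; 0];
      [:: 3638; 0; 3634; 0; 0; 2155; 0; 1479; 3629; 0; 0];
      [:: 3588; 3584; 0; 0; 3584; 0; 0; 1965; 0; 1617];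
      [:: 12073; 0; 0; 8622; 1862; 2773; 10443; 0; 1617]; [:: 0; 0; 0; 0; 0; 0; 0; 0];
      [:: 1637; 450; 1136; 295; 1624; 0; 0]; [:: 9076; 0; 0; 7451; 0; 1617];
      [:: 3001; 1589; 2992; 0; 0]; [:: 3072; 3062; 0; 0]; [:: 12072; 0; 0]; [:: 0; 0];
      [:: 1621]];
  [:: [:: 13723; 5150; 5150; 1974; 12075; 0; 1637; 9076; 3103; 3072; 12072; 1621; 0];
      [:: 5150; 0; 0; 3841; 0; 1306; 3746; 1400; 0; 5142; 0; 0];
      [:: 5150; 0; 5147; 0; 0; 3777; 0; 1369; 3852; 1292; 0];
      [:: 1974; 1971; 0; 0; 1971; 0; 0; 1966; 0; 0];
      [:: 12075; 0; 0; 8649; 1943; 2780; 10445; 1617; 0]; [:: 0; 0; 0; 0; 0; 0; 0; 0];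
      [:: 1637; 424; 1156; 289; 1623; 0; 0]; [:: 9076; 0; 0; 8639; 428; 0];
      [:: 3103; 1699; 2805; 291; 0]; [:: 3072; 1926; 1139; 0]; [:: 12072; 0; 0];
      [:: 1621; 0]; [:: 0]]].

Definition level2_matrices : seq (seq (seq Z)) := map (symmetric_table 13) [::
  [:: [:: 14850; 0; 5150; 5150; 11584; 3174; 1612; 11584; 1612; 3174; 10023; 3174; 3174];
      [:: 0; 0; 0; 0; 0; 0; 0; 0; 0; 0; 0; 0];
      [:: 5150; 0; 5149; 0; 0; 3671; 0; 1477; 3505; 1644; 0];
      [:: 5150; 3671; 1477; 0; 5149; 0; 0; 3505; 0; 1644];
      [:: 11584; 0; 0; 8462; 1472; 3119; 7038; 3038; 2897];
      [:: 3174; 1559; 3119; 52; 0; 2897; 133; 274]; [:: 1612; 1472; 139; 52; 1610; 0; 0];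
      [:: 11584; 0; 0; 7038; 2897; 3038]; [:: 1612; 1559; 1610; 0; 0];
      [:: 3174; 2897; 274; 133]; [:: 10023; 0; 0]; [:: 3174; 1525]; [:: 3174]];
  [:: [:: 15172; 3588; 5149; 3588; 15172; 0; 0; 10422; 3100; 3100; 10422; 3100; 3100];
      [:: 3588; 0; 0; 3588; 0; 0; 1952; 1635; 0; 3587; 0; 0];
      [:: 5149; 0; 5149; 0; 0; 3648; 0; 1500; 3648; 1500; 0];
      [:: 3588; 3588; 0; 0; 3587; 0; 0; 1952; 0; 1635];
      [:: 15172; 0; 0; 10422; 3100; 3100; 10422; 3100; 3100]; [:: 0; 0; 0; 0; 0; 0; 0; 0];
      [:: 0; 0; 0; 0; 0; 0; 0]; [:: 10422; 0; 0; 5834; 2964; 2966];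
      [:: 3100; 1464; 2966; 133; 0]; [:: 3100; 2964; 133; 133]; [:: 10422; 0; 0];
      [:: 3100; 1464]; [:: 3100]];
  [:: [:: 16826; 5150; 5150; 3588; 15172; 0; 1637; 12072; 3103; 3174; 12072; 3103; 3103];
      [:: 5150; 0; 0; 3516; 0; 1632; 3600; 1548; 0; 5148; 0; 0];
      [:: 5150; 0; 5148; 0; 0; 3636; 0; 1512; 3636; 1512; 0];
      [:: 3588; 3586; 0; 0; 3586; 0; 0; 1972; 0; 1614];
      [:: 15172; 0; 0; 11347; 2185; 3168; 10431; 3099; 3097]; [:: 0; 0; 0; 0; 0; 0; 0; 0];
      [:: 1637; 714; 916; 0; 1632; 0; 0]; [:: 12072; 0; 0; 7431; 2996; 2996];
      [:: 3103; 1553; 3000; 102; 0]; [:: 3174; 3067; 102; 102]; [:: 12072; 0; 0];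
      [:: 3103; 1482]; [:: 3103]]].

Definition level3_matrix : seq (seq Z) := symmetric_table 13
  [:: [:: 20000; 5150; 5150; 5150; 15172; 3174; 3174; 15172; 3174; 3174; 15172; 3174; 3174];
      [:: 5150; 0; 0; 3588; 0; 1562; 3588; 1562; 0; 5149; 0; 0];
      [:: 5150; 0; 5149; 0; 0; 3588; 0; 1562; 3588; 1562; 0];
      [:: 5150; 3588; 1562; 0; 5149; 0; 0; 3588; 0; 1562];
      [:: 15172; 0; 0; 10422; 3100; 3100; 10422; 3100; 3100];
      [:: 3174; 1537; 3100; 71; 0; 3100; 71; 71]; [:: 3174; 3100; 71; 71; 3100; 0; 71];
      [:: 15172; 0; 0; 10422; 3100; 3100]; [:: 3174; 1537; 3100; 71; 0];
      [:: 3174; 3100; 71; 71]; [:: 15172; 0; 0]; [:: 3174; 1537]; [:: 3174]].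

Local Close Scope Z_scope.

Definition G41_vertices : seq 'I_12 :=
  [:: v1; v2; v3; v4_0; v4_1; v4_2; v5_0; v5_1; v5_2; v6_0; v6_1; v6_2].

Lemma mem_G41_vertices v : v \in G41_vertices.
Proof. by rewrite -(mem_map val_inj) (mem_iota 0 12) /=. Qed.

Lemma G41_stable_card (S : {set 'I_12}) : stable G41 S -> (#|S| <= 4)%N.
Proof. by apply: stability_number_le_card mem_G41_vertices; vm_compute. Qed.

Lemma G41_automorphisms_endomorphism :
  all (is_endomorphism G41 G41_edges) G41_automorphisms.
Proof. by vm_compute. Qed.

Lemma stable_combinations_stable : all (is_stable_comb G41) stable_combinations.
Proof. by vm_compute. Qed.

Lemma level1_certified (R : realType) :
  certified R G41 1 (map (head [::]) level1_matrices).
Proof. by apply: (certified1 R (G := G41) (E := G41_edges) (fun _ _ => erefl)); vm_compute. Qed.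

Lemma level2_certified (R : realType) :
  certified R G41 2 (map (head [::]) level2_matrices).
Proof.
apply: (certifiedS (G := G41) (fun _ _ => erefl) G41_automorphisms_endomorphism
  stable_combinations_stable (@level1_certified R)).
by vm_compute.
Qed.

Lemma level3_certified (R : realType) : certified R G41 3 [:: head [::] level3_matrix].
Proof.
apply: (certifiedS (G := G41) (Ms := [:: level3_matrix]) (fun _ _ => erefl)
  G41_automorphisms_endomorphism stable_combinations_stable (@level2_certified R)).
by vm_compute.
Qed.

Lemma LSplus_iter3_G41_not_STAB (R : realType) :
  ~ (LSplus_iter 3 G41 `<=` STAB (R := R) G41).
Proof.
move=> sub3; set c := head [::] level3_matrix.
have := cone_subset sub3 (level3_certified R (mem_head c [::])).
move=> /(cone_STAB_sum_le G41_stable_card); apply/negP; rewrite -ltNge.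
rewrite seqcol0; under eq_bigr do rewrite seqcolS.
rewrite -rmorph_sum -(rmorph_nat (ZtoR R)) -rmorphM ltr_ZtoR.
by rewrite !big_ord_recl big_ord0; vm_compute.
Qed.

Theorem theorem22 (R : realType) : is_LSplus_rank R G41 4.
Proof.
split=> [|j j4 LSj_STAB]; first exact: LSplus_iter_STAB.
apply: (@LSplus_iter3_G41_not_STAB R).
by rewrite -LSj_STAB; apply: LSplus_iter_subset.
Qed.
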